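(* Let $d\ge1$ and $0<p\leq \infty$. Then $$b^{1/p}_{p,\infty}(\mathbb{R}^d)\cap\operatorname{span} \mathscr{H}_d=\{0\}.$$
   Context: $B^s_{p,q}(\mathbb{R}^d)$ is the usual inhomogeneous Besov space, and $b^s_{p,q}(\mathbb{R}^d)$ denotes the closure of the Schwartz class $\mathcal{S}(\mathbb{R}^d)$ in $B^s_{p,q}(\mathbb{R}^d)$. For $p=\infty$, $1/p=0$. Haar system: let $h^{(0)}=\mathbf{1}_{[0,1)}$ and $h^{(1)}=\mathbf{1}_{[0,1/2)}-\mathbf{1}_{[1/2,1)}$ on $\mathbb{R}$. For $\epsilon\in\{0,1\}^d$, $k\in\mathbb{N}_0$, $\mu\in\mathbb{Z}^d$ put $h^{\epsilon}_{k,\mu}(x)=\prod_{i=1}^d h^{(\epsilon_i)}(2^kx_i-\mu_i)$. With $\Upsilon=\{0,1\}^d\setminus\{\vec 0\}$, $\mathscr{H}_d=\{h^{\vec 0}_{0,\mu}\}_{\mu\in\mathbb{Z}^d}\cup\{h^{\epsilon}_{k,\mu}: k\in\mathbb{N}_0,\mu\in\mathbb{Z}^d,\epsilon\in\Upsilon\}$. $\operatorname{span}\mathscr{H}_d$ is the vector space of all finite linear combinations of Haar functions. *)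

(* Defs.v *)
From HB Require Import structures.
From mathcomp Require Import all_boot all_order all_algebra.
From mathcomp Require Import complex.
From mathcomp Require Import all_classical all_reals all_analysis.

Set Implicit Arguments.
Unset Strict Implicit.
Unset Printing Implicit Defensive.

Import Order.TTheory GRing.Theory Num.Theory.
Import numFieldNormedType.Exports.

Local Open Scope classical_set_scope.
Local Open Scope ring_scope.
Local Open Scope complex_scope.

Definition measure_row_display : measure_display -> measure_display.
Proof. exact. Qed.

Section measurable_row.
Context {d : measure_display} {T : sigmaRingType d}.
Variable n : nat.

Let coors : 'I_n -> 'rV[T]_n -> T := fun i x => x ord0 i.

Let row_set0 : g_sigma_preimage coors set0.
Proof. exact: sigma_algebra0. Qed.

Let row_setC A : g_sigma_preimage coors A -> g_sigma_preimage coors (~` A).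
Proof. exact: sigma_algebraC. Qed.

Let row_bigcup (F : _^nat) : (forall i, g_sigma_preimage coors (F i)) ->
  g_sigma_preimage coors (\bigcup_i (F i)).
Proof. exact: sigma_algebra_bigcup. Qed.

HB.instance Definition _ := @isMeasurable.Build (measure_row_display d)
  'rV[T]_n (g_sigma_preimage coors) row_set0 row_setC row_bigcup.

End measurable_row.

Lemma measurable_fun_rowP d1 d2 (T1 : measurableType d1)
    (T2 : measurableType d2) n (f : T1 -> 'rV[T2]_n) :
  (forall i, measurable_fun [set: T1] (fun x => f x ord0 i)) ->
  measurable_fun [set: T1] f.
Proof.
move=> mf _ A mA; rewrite setTI.
suff : image_set_system setT f measurable A.
  by rewrite /image_set_system/= setTI.
have : <<s \big[setU/set0]_(i < n)
    preimage_set_system setT (fun x : 'rV[T2]_n => x ord0 i) measurable >> A.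
  exact: mA.
apply; split; first exact/sigma_algebra_image/sigma_algebra_measurable.
move=> B; rewrite -bigcup_seq => -[i _] [C mC <-].
rewrite /image_set_system/= !setTI.
by have := mf i measurableT C mC; rewrite setTI.
Qed.

Section lebesgue_Rd.
Context {R : realType}.

Definition row_cons n (p : measurableTypeR R * 'rV[R]_n) : 'rV[R]_n.+1 :=
  row_mx (const_mx p.1 : 'rV_1) p.2.

Lemma measurable_row_cons n : measurable_fun [set: _] (@row_cons n).
Proof.
apply: measurable_fun_rowP => i; case: (@split_ordP 1 n i) => j ->.
- rewrite [X in measurable_fun _ X](_ : _ = fst); last first.
    by apply/funext => p; rewrite [LHS]row_mxEl mxE.
  exact: measurable_fst.
- rewrite [X in measurable_fun _ X](_ : _ =
      (fun x : 'rV[R]_n => x ord0 j) \o snd); last first.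
    by apply/funext => p; exact: row_mxEr.
  apply: measurableT_comp => // _ A mA; rewrite setTI.
  apply: sub_sigma_algebra; rewrite -bigcup_seq; exists j => /=.
    by rewrite mem_index_enum.
  by exists A => //; rewrite setTI.
Qed.

(* the product is \x^ and not \x because its measure structure asks for
   sigma-finiteness of the left factor only *)
Fixpoint lebesgue_Rd (n : nat) : {measure set 'rV[R]_n -> \bar R} :=
  match n with
  | 0 => \d_(0 : 'rV[R]_0)
  | m.+1 => measure_function_pushforward__canonical__measure_function_Measure
      (lebesgue_measure \x^ lebesgue_Rd m)%E (@measurable_row_cons m)
  end.

End lebesgue_Rd.

Section function_spaces.
Context {R : realType} {d : nat}.

Local Notation Rd := 'rV[R]_d.
Local Notation C := R[i].
Local Notation mu := (@lebesgue_Rd R d).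

Implicit Types (phi psi g : Rd -> C) (T U : (Rd -> C) -> C).

Definition cabs (z : C) : R := complex.Re `|z|.

Definition cintegral phi : C :=
  (\int[mu]_x complex.Re (phi x)) +i* (\int[mu]_x complex.Im (phi x)).

Definition Lp_norm (p : \bar R) phi : \bar R :=
  Lnorm mu p (fun x => (cabs (phi x))%:E).

(* iterated partial derivative, one coordinate direction per entry of s *)
Definition partial (s : seq 'I_d) (f : Rd -> R) : Rd -> R :=
  foldr (fun i h x => 'D_(delta_mx ord0 i) h x) f s.

Definition cpartial (s : seq 'I_d) phi (x : Rd) : C :=
  partial s (fun y => complex.Re (phi y)) x
  +i* partial s (fun y => complex.Im (phi y)) x.

Definition smooth (f : Rd -> R) : Prop :=
  forall (s : seq 'I_d) (x : Rd), differentiable (partial s f) x.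

Definition schwartz_seminorm (N : nat) phi : \bar R :=
  ereal_sup [set ((1 + `|a.2|) ^+ N * cabs (cpartial a.1 phi a.2))%:E
            | a in [set a : seq 'I_d * Rd | (size a.1 <= N)%N]].

Definition schwartz phi : Prop :=
  [/\ smooth (fun x => complex.Re (phi x)),
      smooth (fun x => complex.Im (phi x)) &
      forall N, (schwartz_seminorm N phi < +oo)%E].

(* Distributions are total functionals, of which only the values on Schwartz
   functions matter *)
Definition tempered_distribution T : Prop :=
  (forall (a : C) phi psi, schwartz phi -> schwartz psi ->
     T (fun x => a * phi x + psi x) = a * T phi + T psi) /\
  exists (N : nat) (K : R), forall phi, schwartz phi ->
    ((cabs (T phi))%:E <= K%:E * schwartz_seminorm N phi)%E.

Definition dist_of_fun (f : Rd -> C) : (Rd -> C) -> C :=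
  fun phi => cintegral (fun x => f x * phi x).

Definition dist_sub T U : (Rd -> C) -> C := fun phi => T phi - U phi.

Definition dotr (x y : Rd) : R := \sum_(i < d) x ord0 i * y ord0 i.

Definition fourier phi (xi : Rd) : C :=
  cintegral (fun x => phi x * (cos (dotr x xi) -i* sin (dotr x xi))).

(* Phi is the inverse Fourier transform of a smooth phi_0 with phi_0 = 1 on the
   unit ball and phi_0 = 0 off the ball of radius 2; the Besov spaces do not
   depend on this choice, up to equivalence of quasi-norms *)
Definition LP_kernel (Phi : Rd -> C) : Prop :=
  [/\ schwartz Phi,
      forall xi, dotr xi xi <= 1 -> fourier Phi xi = 1 &
      forall xi, 4 <= dotr xi xi -> fourier Phi xi = 0].

Definition dilate (j : nat) (Phi : Rd -> C) (x : Rd) : C :=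
  ((2 ^+ (j * d))%:C) * Phi (2 ^+ j *: x).

(* inverse Fourier transform of phi_k, where phi_k = phi_0(2^-k .) -
   phi_0(2^-(k-1) .) for k >= 1; these form a dyadic resolution of unity *)
Definition LP_block_kernel (Phi : Rd -> C) (k : nat) (x : Rd) : C :=
  if k is j.+1 then dilate j.+1 Phi x - dilate j Phi x else Phi x.

(* the function F^-1[phi_k F T], i.e. the convolution of T with F^-1[phi_k] *)
Definition LP_block (Phi : Rd -> C) (k : nat) T (x : Rd) : C :=
  T (fun y => LP_block_kernel Phi k (x - y)).

Definition besov_norm (Phi : Rd -> C) (s : R) (p q : \bar R) T : \bar R :=
  Lnorm counting q (fun k : nat =>
    (2 `^ (s * k%:R))%:E * Lp_norm p (LP_block Phi k T))%E.

Definition besov Phi (s : R) (p q : \bar R) : set ((Rd -> C) -> C) :=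
  [set T | tempered_distribution T /\ (besov_norm Phi s p q T < +oo)%E].

Definition besov_schwartz_closure Phi (s : R) (p q : \bar R) : set ((Rd -> C) -> C) :=
  [set T | besov Phi s p q T /\
     forall e : R, 0 < e -> exists g, schwartz g /\
       (besov_norm Phi s p q (dist_sub T (dist_of_fun g)) < e%:E)%E].

Definition haar1 (e : bool) (t : R) : R :=
  if e then \1_(`[0, 2^-1[%classic) t - \1_(`[2^-1, 1[%classic) t
  else \1_(`[0, 1[%classic) t.

Definition haar (e : {ffun 'I_d -> bool}) (k : nat) (m : {ffun 'I_d -> int})
    (x : Rd) : C :=
  (\prod_(i < d) haar1 (e i) (2 ^+ k * x ord0 i - (m i)%:~R))%:C.

Definition haar_system : set (Rd -> C) :=
  [set haar [ffun=> false] 0 m | m in [set: {ffun 'I_d -> int}]] `|`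
  [set h | exists k m e, e != [ffun=> false] /\ h = haar e k m].

Definition cspan (H : set (Rd -> C)) : set (Rd -> C) :=
  [set f | exists (n : nat) (c : 'I_n -> C) (h : 'I_n -> Rd -> C),
     (forall j, H (h j)) /\ f = fun x => \sum_(j < n) c j * h j x].

End function_spaces.

Definition inv_exponent {R : realType} (p : \bar R) : R :=
  if p is r%:E then r^-1 else 0.

(* Main.v *)
Require Import Defs.
From mathcomp Require Import all_boot all_order all_algebra.
From mathcomp Require Import complex.
From mathcomp Require Import all_classical all_reals all_analysis.
From mathcomp Require Import measurable_realfun ess_sup_inf.
From mathcomp Require Import ring lra.

Set Implicit Arguments.
Unset Strict Implicit.
Unset Printing Implicit Defensive.

Import Order.TTheory GRing.Theory Num.Theory.
Import numFieldNormedType.Exports.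

Local Open Scope classical_set_scope.
Local Open Scope ring_scope.
Local Open Scope complex_scope.

(** A nonzero [f] in the span of the Haar system has a jump, and a jump alone
keeps 2^(k/p) ||L_k (f - g)||_p away from 0 as k grows, by an amount that does
not depend on the Schwartz function [g]; here L_k is the k-th Littlewood-Paley
block.

The jump: [f] is constant on the dyadic cubes of some generation and vanishes
far out in the first coordinate direction. Walking in this direction from a cube
where [f] is nonzero, one meets two neighbouring cubes with values v <> 0 and 0
([jump_face]). Hence [f] is v times the indicator of a half-space near a point z
of their common face.

The blocks: L_(k+1) = A_(k+1) - A_k, where
A_k w x = int w (x - 2^-k u) Phi u du. If x is near z, at signed height
2^-(k+1) t above the face, then f (x - 2^-(k+1) u) is v when u_0 > t and 0
otherwise, except for |u| of size at least 2^k, where the decay of Phi takes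
over. With P t = int_(u_0 > t) Phi, this gives A_(k+1) f x = v P t + O(2^-k)
and A_k f x = v P (t / 2) + O(2^-k) ([face_average]). A Schwartz [g] is
Lipschitz, so both averages of [g] are g x + O(2^-k) ([smooth_average]) and the
block removes them. Therefore
L_(k+1) (f - g) x = v (P t - P (t / 2)) + O(2^-k) ([block_approx]), uniformly
over the points near z with t in a fixed interval. These points fill a slab of
measure comparable to 2^-k, which is exactly what the weight 2^(k/p)
compensates ([besov_face_lower]).

The profile: P t - P (t / 2) cannot vanish for every t. Otherwise
P (2^j t) = P t for every integer j; letting j tend to +oo gives P = 0 on the
positive half-line and, Phi having integral 1, P = 1 on the negative one, so
that P jumps at 0 although the hyperplane u_0 = 0 is null
([profile_not_dilation_invariant]). By right continuity of P the difference then
stays away from 0 on a whole interval ([profile_gap]). *)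

(** * The sup norm on row vectors *)

Section norm.
Context {R : realType}.

Lemma coord_le_norm n (x : 'rV[R]_n) i : `|x ord0 i| <= `|x|.
Proof.
rewrite (_ : `|x| = \big[Num.max/0]_ij `|x ij.1 ij.2|); last exact: mx_normrE.
exact: (le_bigmax _ (fun ij : 'I_1 * 'I_n => `|x ij.1 ij.2|) (ord0, i)).
Qed.

Lemma norm_le_coord n (x : 'rV[R]_n) c : 0 <= c ->
  (forall i, `|x ord0 i| <= c) -> `|x| <= c.
Proof.
move=> c0 H; rewrite (_ : `|x| = \big[Num.max/0]_ij `|x ij.1 ij.2|);
  last exact: mx_normrE.
by apply: bigmax_le => // -[i j] _ /=; rewrite ord1.
Qed.

End norm.

(** * Boxes and Lebesgue measure *)

Section boxes.
Context {R : realType}.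

Definition box n (A : 'I_n -> set R) : set 'rV[R]_n :=
  [set x | forall i, A i (x ord0 i)].

Lemma measurable_coord n (i : 'I_n) :
  measurable_fun [set: 'rV[R]_n] (fun x => x ord0 i : measurableTypeR R).
Proof.
move=> _ A mA; rewrite setTI.
apply: sub_sigma_algebra; rewrite -bigcup_seq; exists i => /=.
  by rewrite mem_index_enum.
by exists A => //; rewrite setTI.
Qed.

Lemma measurable_box n (A : 'I_n -> set (measurableTypeR R)) :
  (forall i, measurable (A i)) -> measurable (box A).
Proof.
move=> mA.
rewrite (_ : box A = \big[setI/setT]_(i < n) ((fun x :
  'rV[R]_n => x ord0 i) @^-1` A i)).
  apply: big_ind => //; first exact: measurableI.
  by move=> i _; rewrite -[X in measurable X]setTI; exact: measurable_coord.
rewrite -bigcap_seq; apply/seteqP; split => x /= H i; first by move=> _; exact: H.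
by apply: H; rewrite /= mem_index_enum.
Qed.

Lemma row_cons0 n s (v : 'rV[R]_n) : row_cons (s, v) ord0 ord0 = s.
Proof.
transitivity (row_cons (s, v) ord0 (@lshift 1 n ord0)).
  by congr (_ _ _); exact: val_inj.
by rewrite [LHS]row_mxEl mxE.
Qed.

Lemma row_consS n s (v : 'rV[R]_n) i : row_cons (s, v) ord0 (lift ord0 i)
  = v ord0 i.
Proof.
rewrite /row_cons (_ : lift ord0 i = @rshift 1 n i); last exact: val_inj.
by rewrite [LHS]row_mxEr.
Qed.

(** The recursive definition of [lebesgue_Rd] enters the rest of the argument only
through its values on boxes, which determine the measure. *)
Lemma lebesgue_Rd_box n (A : 'I_n -> set (measurableTypeR R)) :
  (forall i, measurable (A i)) ->
  lebesgue_Rd n (box A) = (\prod_(i < n) lebesgue_measure (A i))%E.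
Proof.
elim: n A => [|n IH] A mA.
  rewrite big_ord0 /= diracE mem_set//.
  by move=> [].
rewrite big_ord_recl -IH; last by move=> i; exact: mA.
rewrite /= /pushforward -product_measure2E//; last exact: measurable_box.
congr (product_measure2 _ _ _); apply/seteqP; split => -[s v] /=.
  move=> H; split; first by have := H ord0; rewrite row_cons0.
  by move=> i; have := H (lift ord0 i); rewrite row_consS.
move=> [H1 H2] i; have [j ->|->] := unliftP ord0 i; last by rewrite row_cons0.
by rewrite row_consS; exact: H2.
Qed.

End boxes.

(** * Lebesgue measure under affine maps *)

Section affine.
Context {R : realType}.

Local Notation pfmeasure :=
  measure_function_pushforward__canonical__measure_function_Measure.

Lemma measurable_affine_line (b s : R) :
  measurable_fun [set: measurableTypeR R] (fun t => b - s * t : measurableTypeR R).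
Proof. by apply: measurable_funB => //; exact: measurable_funM. Qed.

(** The right-hand side is a measure in [A], so that it is enough to compare both
sides on half-open intervals. *)
Lemma lebesgue_measure_affine (b s : R) (A : set (measurableTypeR R)) :
  0 < s -> measurable A ->
  lebesgue_measure A = (s%:E * lebesgue_measure ((fun t => b - s * t)%R @^-1` A))%E.
Proof.
move=> s0 mA.
pose m := mscale (NngNum (ltW s0)) (pfmeasure lebesgue_measure
  (measurable_affine_line b s)).
rewrite -[RHS]/(m A); apply: lebesgue_measure_unique => // X [[u v] _ <-] /=.
rewrite /m/= /mscale/= /pushforward.
rewrite [X in lebesgue_measure X = _]/= lebesgue_measure_itv/=.
(* The reflection turns ]u, v] into an interval closed on the left. *)
rewrite (_ : _ @^-1` _ = `[(b - v) / s, (b - u) / s[%classic); last first.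
  apply/seteqP; split => t /=; rewrite !in_itv/= ler_pdivrMr// ltr_pdivlMr// =>
    /andP[? ?]; apply/andP; split; lra.
rewrite lebesgue_measure_itv/= !lte_fin ltr_pM2r ?invr_gt0//.
rewrite ltrD2l ltrN2; case: ifPn => _; last by rewrite mule0.
rewrite -EFinD -EFinB -EFinM; congr (_%:E); field.
by rewrite gt_eqF.
Qed.

(** Boxes with measurable sides form a pi-system, which makes this generating family
suitable for comparing measures. *)
Lemma row_measurableE n :
  (@measurable _ 'rV[measurableTypeR R]_n) = <<s [set box A | A in [set A :
    'I_n -> set (measurableTypeR R) | forall i, measurable (A i)]] >>.
Proof.
apply/seteqP; split.
  apply: smallest_sub; first exact: smallest_sigma_algebra.
  move=> B; rewrite -bigcup_seq => -[i _] [C mC <-].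
  apply: sub_sigma_algebra.
  exists (fun j => if j == i then C else setT).
    by move=> j; case: ifP.
  apply/seteqP; split => x /=.
    by move=> /(_ i); rewrite eqxx.
  by move=> [_ xC] j; case: eqP => [->|].
apply: smallest_sub; first exact: sigma_algebra_measurable.
by move=> B [A mA <-]; exact: measurable_box.
Qed.

Lemma measurable_affine n (x : 'rV[R]_n) (s : R) :
  measurable_fun [set: 'rV[R]_n] (fun u => x - s *: u).
Proof.
apply: measurable_fun_rowP => i.
apply: (eq_measurable_fun (fun u : 'rV[R]_n => (x ord0 i - s * u ord0 i :
  measurableTypeR R))).
  by move=> u _; rewrite !mxE.
apply: measurable_funB => //; apply: measurable_funM => //.
exact: measurable_coord.
Qed.

(** Both sides are measures in [A]; on a box the identity is the one-dimensional one
in each coordinate, and cubes exhaust the space. *)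
Lemma lebesgue_Rd_affine n (x : 'rV[R]_n) (s : R) (A : set 'rV[R]_n) :
  0 < s -> measurable A ->
  lebesgue_Rd n A = ((s ^+ n)%:E * lebesgue_Rd n ((fun u =>
    x - s *: u)%R @^-1` A))%E.
Proof.
move=> s0 mA.
pose m := mscale (NngNum (exprn_ge0 n (ltW s0))) (pfmeasure (lebesgue_Rd n)
  (measurable_affine x s)).
rewrite -[RHS]/(m A).
apply: (measure_unique _ (fun k => box (fun=> `]-k%:R, k%:R]%classic))
  (@row_measurableE n)) => //.
- move=> _ _ [A1 mA1 <-] [A2 mA2 <-].
  exists (fun i => A1 i `&` A2 i); first by move=> i; exact: measurableI.
  apply/seteqP; split => y /=; first by move=> H; split => i; have [] := H i.
  by move=> [H1 H2] i; split.
- by move=> k; exists (fun=> `]-k%:R, k%:R]%classic).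
- apply/seteqP; split => // y _.
  exists (Num.truncn `|y|).+1 => // i.
  have : `|y ord0 i| < (Num.truncn `|y|).+1%:R.
    by apply: le_lt_trans (truncnS_gt _); exact: coord_le_norm.
  by rewrite /= in_itv/= ltr_norml => /andP[-> /ltW].
- move=> _ [B mB <-] /=.
  rewrite /m/= /mscale/= /pushforward.
  rewrite (_ : _ @^-1` _ = box (fun i => (fun t =>
    x ord0 i - s * t) @^-1` B i)); last first.
    by apply/seteqP; split => y /= H i; have := H i; rewrite !mxE.
  have mpB i : measurable ((fun t : measurableTypeR R => x ord0 i - s * t :
    measurableTypeR R) @^-1` B i).
    rewrite -[X in measurable X]setTI.
    exact: measurable_affine_line.
  rewrite !lebesgue_Rd_box//.
  rewrite (_ : (s ^+ n)%:E = \prod_(i < n) s%:E)%E; last first.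
    by rewrite prodEFin prodr_const card_ord.
  rewrite -big_split; apply: eq_bigr => i _.
  exact: lebesgue_measure_affine.
- move=> k; rewrite lebesgue_Rd_box//.
  under eq_bigr do rewrite lebesgue_measure_itv/=.
  rewrite (eq_bigr (fun=> (if -k%:R < k%:R :> R then k%:R - - k%:R else 0)%:E)).
    by rewrite prodEFin ltry.
  by move=> i _; rewrite lte_fin; case: ifP.
Qed.

End affine.

(** * Dyadic rounding and measurability *)

Section step_maps.
Context {R : realType}.

Definition dyadic_value (K : nat) (t : R) : R :=
  (Num.floor (2 ^+ K * t))%:~R / 2 ^+ K.

Definition dyadic_floor n (K : nat) (x : 'rV[R]_n) : 'rV[R]_n :=
  \row_i dyadic_value K (x ord0 i).

Lemma exp2_gt0 K : 0 < 2 ^+ K :> R. Proof. exact: exprn_gt0. Qed.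

Lemma natr_le_exp2 k : k%:R <= 2 ^+ k :> R.
Proof. by rewrite -natrX ler_nat ltnW// ltn_expl. Qed.

Lemma dyadic_floor_le n K (x : 'rV[R]_n) i : dyadic_floor K x ord0 i <= x ord0 i.
Proof. by rewrite mxE /dyadic_value ler_pdivrMr ?exp2_gt0// mulrC floor_le. Qed.

Lemma dyadic_floor_gt n K (x : 'rV[R]_n) i :
  x ord0 i < dyadic_floor K x ord0 i + 2 ^- K.
Proof.
rewrite mxE /dyadic_value -[X in _ + X]mul1r -mulrDl ltr_pdivlMr ?exp2_gt0// mulrC.
by rewrite -[X in _ + X]/(1%:~R) -rmorphD floorD1_gt.
Qed.

(** The map [dyadic_floor K] takes countably many values, each of them on a box;
hence whatever is composed with it becomes measurable. *)
Lemma measurable_step n K (f : 'rV[R]_n -> R) :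
  measurable_fun [set: 'rV[R]_n] (fun x => f (dyadic_floor K x) :
    measurableTypeR R).
Proof.
move=> _ B mB; rewrite setTI.
pose F (z : 'rV[int]_n) := if `[< B (f (\row_i ((z ord0 i)%:~R / 2 ^+ K))) >] then
  box (fun i => `[(z ord0 i)%:~R / 2 ^+ K,
    (z ord0 i + 1)%:~R / 2 ^+ K[%classic : set R) else set0.
rewrite (_ : _ @^-1` B = \bigcup_z F z).
  apply: countable_bigcupT_measurable => // z; rewrite /F; case: ifP => // _.
  by apply: measurable_box => i; exact: measurable_itv.
apply/seteqP; split => x /=.
  move=> Bx; exists (\row_i Num.floor (2 ^+ K * x ord0 i)) => //.
  rewrite /F; case: asboolP => /=; last first.
    case; congr (B (f _)) : Bx; by apply/rowP => i; rewrite !mxE.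
  move=> _ i; rewrite /= mxE in_itv/= ler_pdivrMr ?exp2_gt0// ltr_pdivlMr
    ?exp2_gt0//.
  by rewrite mulrC floor_itv.
move=> [z _]; rewrite /F; case: asboolP => // Bz H.
congr (B (f _)) : Bz; apply/rowP => i; rewrite !mxE /dyadic_value.
have := H i; rewrite /= in_itv/= ler_pdivrMr ?exp2_gt0// ltr_pdivlMr ?exp2_gt0//
  mulrC.
by move=> /floor_def ->.
Qed.

(** Continuity makes [f] the pointwise limit of its dyadic roundings. *)
Lemma measurable_continuous n (f : 'rV[R]_n -> R) :
  continuous f -> measurable_fun [set: 'rV[R]_n] (f : _ -> measurableTypeR R).
Proof.
move=> cf; apply: (measurable_fun_cvg (h := fun K x => f (dyadic_floor K x))).
  by move=> K; exact: measurable_step.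
move=> x _; apply: (cvg_comp _ f); last exact: cf.
apply/cvgrPdist_le => e e0; near=> K.
have : 2 ^- K <= e.
  near: K.
  have /cvgrPdist_le /(_ _ e0) : (fun K => (2^-1 : R) ^+ K) @ \oo --> 0.
    by apply: cvg_expr; rewrite ger0_norm ?invr_ge0// invf_lt1// ltr1n.
  apply: filterS => K; rewrite sub0r normrN ger0_norm ?exprn_ge0 ?invr_ge0//.
  by rewrite exprVn.
apply: le_trans; apply: norm_le_coord; first by rewrite invr_ge0 ltW ?exp2_gt0.
move=> i; rewrite !mxE.
have := dyadic_floor_le K x i; have := dyadic_floor_gt K x i; rewrite !mxE => H1 H2.
rewrite ler_norml; apply/andP; split; lra.
Unshelve. all: by end_near. Qed.

End step_maps.

(** * Integrability of rapidly decaying functions *)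

Section decay.
Context {R : realType}.

Lemma dyadic_scale (y : R) : 1 <= y -> exists j, 2 ^+ j <= y < 2 ^+ j.+1.
Proof.
move=> y1.
have t1 : (0 < Num.truncn y)%N by rewrite truncn_gt0.
exists (trunc_log 2 (Num.truncn y)).
have /andP[l u] := trunc_log_bounds (isT : (1 < 2)%N) t1.
have /andP[ty yt] := truncn_itv (le_trans ler01 y1).
rewrite -!natrX; apply/andP; split; first by rewrite (le_trans _ ty)// ler_nat.
by rewrite (lt_le_trans yt)// ler_nat.
Qed.

Lemma lebesgue_Rd_cube n (c : R) : 0 <= c ->
  lebesgue_Rd n (box (fun=> `[-c, c]%classic)) = ((2 * c) ^+ n)%:E.
Proof.
move=> c0; rewrite lebesgue_Rd_box//.
rewrite (eq_bigr (fun=> (2 * c)%:E)); last first.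
  move=> i _; rewrite lebesgue_measure_itv/= lte_fin; case: ifPn => [_|].
    by rewrite -EFinB; congr (_%:E); ring.
  by rewrite -leNgt => ?; congr (_%:E); lra.
by rewrite prodEFin prodr_const card_ord.
Qed.

(** On the shell 2^j <= 1 + |u| < 2^(j+1) the function is at most K 2^(-j(n+1)), and
the shell lies in a cube of volume 4^n 2^(jn): a geometric series remains. *)
Lemma integrable_decay n (h : 'rV[R]_n -> R) (K : R) :
  measurable_fun [set: 'rV[R]_n] (h : _ -> measurableTypeR R) ->
  (forall u, (1 + `|u|) ^+ n.+1 * `|h u| <= K) ->
  (lebesgue_Rd n).-integrable setT (EFin \o h).
Proof.
move=> mh hK.
have K0 : 0 <= K by rewrite (le_trans _ (hK 0))// mulr_ge0// exprn_ge0// addr_ge0.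
pose B j := box (fun=> `[- 2 ^+ j.+1, 2 ^+ j.+1]%classic :
  set (measurableTypeR R)) : set 'rV[R]_n.
have mB j : measurable (B j) by apply: measurable_box => i; exact: measurable_itv.
pose c j : R := K / 2 ^+ (j * n.+1).
have c0 j : 0 <= c j by rewrite divr_ge0// exprn_ge0.
pose g j (u : 'rV[R]_n) := ((c j)%:E * (\1_(B j) u)%:E)%E.
have g0 j u : (0 <= g j u)%E by rewrite mule_ge0// lee_fin ?c0.
have mg j : measurable_fun setT (g j).
  by apply: measurable_funeM; apply/measurable_EFinP; exact: measurable_indic.
apply/integrableP; split; first exact/measurable_EFinP.
apply: (@le_lt_trans _ _ (\int[lebesgue_Rd n]_u (\sum_(0 <= j <oo) g j u))%E).
  apply: ge0_le_integral => //.
  - by apply: measurableT_comp => //; exact/measurable_EFinP.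
  - by apply: ge0_emeasurable_sum.
  move=> u _.
  have [|j /andP[l r]] := @dyadic_scale (1 + `|u|); first by rewrite lerDl.
  apply: (@le_trans _ _ (g j u)).
    rewrite /g indicE mem_set ?mule1 /c; last first.
      move=> i /=; rewrite in_itv/= -ler_norml (le_trans (coord_le_norm _ _))//.
      by rewrite (le_trans _ (ltW r))// lerDr.
    rewrite /= lee_fin ler_pdivlMr ?exp2_gt0// mulrC (le_trans _ (hK u))//.
    by rewrite ler_wpM2r// exprM lerXn2r// nnegrE ?addr_ge0// exprn_ge0.
  apply: le_trans; last exact: (nneseries_lim_ge j.+1).
  by rewrite big_nat_recr//= leeDr// sume_ge0.
rewrite integral_nneseries//.
(* The j-th term is K 2^-j 4^n, that is, eps / 2^(j+1). *)
pose eps : R := 2 * K * 4 ^+ n.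
apply: (@le_lt_trans _ _ eps%:E); last exact: ltry.
apply: le_trans (@epsilon_trick0 R eps xpredT _);
  last by rewrite !mulr_ge0// exprn_ge0.
apply: lee_nneseries => [j _ _|j _]; first exact: integral_ge0.
rewrite ge0_integralZl//; last 2 first.
  by apply/measurable_EFinP; exact: measurable_indic.
  by rewrite lee_fin.
rewrite integral_indic// setIT lebesgue_Rd_cube ?exprn_ge0//.
rewrite -EFinM lee_fin natrX /c /eps.
rewrite le_eqVlt; apply/orP; left; apply/eqP.
rewrite mulnS !exprD (exprM _ j n) !exprS !exprMn (_ : 4 = 2 * 2); last by ring.
rewrite exprMn -!exprM; field.
by rewrite !expf_neq0.
Qed.

End decay.

(** * Complex modulus and complex integrals *)

Section complex_modulus.
Context {R : realType}.
Implicit Types z w : R[i].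

Lemma cabsE z : cabs z = Num.sqrt (complex.Re z ^+ 2 + complex.Im z ^+ 2).
Proof. by rewrite /cabs normc_def. Qed.

Lemma cabs_normc z : cabs z = Normc.normc z.
Proof. by rewrite cabsE; case: z. Qed.

Lemma cabs_ge0 z : 0 <= cabs z. Proof. by rewrite cabsE sqrtr_ge0. Qed.

Lemma cabsM z w : cabs (z * w) = cabs z * cabs w.
Proof. by rewrite !cabs_normc Normc.normcM. Qed.

Lemma cabsD z w : cabs (z + w) <= cabs z + cabs w.
Proof. by rewrite !cabs_normc le_normcD. Qed.

Lemma cabsN z : cabs (- z) = cabs z.
Proof. by rewrite !cabs_normc normcN. Qed.

Lemma cabsB z w : cabs (z - w) <= cabs z + cabs w.
Proof. by rewrite -(cabsN w); exact: cabsD. Qed.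

Lemma cabs_real (a : R) : cabs a%:C = `|a|.
Proof. by rewrite cabsE/= expr0n/= addr0 sqrtr_sqr. Qed.

Lemma cabs0 : cabs (0 : R[i]) = 0.
Proof. by rewrite (cabs_real 0) normr0. Qed.

Lemma cabs_gt0 z : z != 0 -> 0 < cabs z.
Proof.
move=> z0; rewrite lt_neqAle cabs_ge0 andbT eq_sym; apply: contraNneq z0.
by rewrite cabs_normc => /Normc.eq0_normc ->.
Qed.

Lemma Re_le_cabs z : `|complex.Re z| <= cabs z.
Proof. by rewrite cabsE -sqrtr_sqr ler_wsqrtr// lerDl sqr_ge0. Qed.

Lemma Im_le_cabs z : `|complex.Im z| <= cabs z.
Proof. by rewrite cabsE -sqrtr_sqr ler_wsqrtr// lerDr sqr_ge0. Qed.

Lemma cabs_le_ReIm z : cabs z <= `|complex.Re z| + `|complex.Im z|.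
Proof.
have {1}-> : z = (complex.Re z)%:C + 'i%C * (complex.Im z)%:C by case: z =>
  a b /=; simpc.
apply: le_trans (cabsD _ _) _; rewrite cabsM !cabs_real.
rewrite lerD// (_ : cabs 'i%C = 1) ?mul1r// cabsE/= expr0n/= add0r expr1n.
exact: sqrtr1.
Qed.

End complex_modulus.

Section complex_integral.
Context {R : realType} {n : nat}.
Local Notation mu := (@lebesgue_Rd R n).
Implicit Types phi psi : 'rV[R]_n -> R[i].

Definition cmeasurable phi :=
  measurable_fun [set: 'rV[R]_n] (fun x => complex.Re (phi x) :
    measurableTypeR R) /\
  measurable_fun [set: 'rV[R]_n] (fun x => complex.Im (phi x) : measurableTypeR R).

Definition cintegrable phi :=
  mu.-integrable setT (fun x => (complex.Re (phi x))%:E) /\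
  mu.-integrable setT (fun x => (complex.Im (phi x))%:E).

Lemma cmeasurableM phi psi : cmeasurable phi -> cmeasurable psi ->
  cmeasurable (fun x => phi x * psi x).
Proof.
move=> [rp ip] [rq iq]; split.
  apply: (eq_measurable_fun (fun x => complex.Re (phi x) * complex.Re
    (psi x) - complex.Im (phi x) * complex.Im (psi x) : measurableTypeR R)).
    by move=> x _; case: (phi x) (psi x) => a b [c e].
  by apply: measurable_funB; exact: measurable_funM.
apply: (eq_measurable_fun (fun x => complex.Re (phi x) * complex.Im
  (psi x) + complex.Im (phi x) * complex.Re (psi x) : measurableTypeR R)).
  by move=> x _; case: (phi x) (psi x) => a b [c e].
by apply: measurable_funD; exact: measurable_funM.
Qed.

Lemma measurable_cabs phi : cmeasurable phi ->
  measurable_fun [set: 'rV[R]_n] (fun x => cabs (phi x) : measurableTypeR R).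
Proof.
move=> [rp ip].
apply: (eq_measurable_fun (fun x => Num.sqrt (complex.Re
  (phi x) ^+ 2 + complex.Im (phi x) ^+ 2) : measurableTypeR R)).
  by move=> x _; rewrite cabsE.
apply: (measurableT_comp (f := Num.sqrt : measurableTypeR R -> measurableTypeR R)).
  by apply: continuous_measurable_fun; exact: sqrt_continuous.
by apply: measurable_funD; exact: measurable_funX.
Qed.

Lemma cmeasurable_cst (c : R[i]) : cmeasurable (fun=> c).
Proof. by split; exact: measurable_cst. Qed.

Lemma cmeasurableB phi psi : cmeasurable phi -> cmeasurable psi ->
  cmeasurable (fun x => phi x - psi x).
Proof.
move=> [rp ip] [rq iq]; split.
  apply: (eq_measurable_fun (fun x => complex.Re (phi x) - complex.Re (psi x) :
    measurableTypeR R)).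
    by move=> x _; case: (phi x) (psi x) => a b [c e].
  exact: measurable_funB.
apply: (eq_measurable_fun (fun x => complex.Im (phi x) - complex.Im (psi x) :
  measurableTypeR R)).
  by move=> x _; case: (phi x) (psi x) => a b [c e].
exact: measurable_funB.
Qed.

Lemma cmeasurable_indic (A : set 'rV[R]_n) : measurable A ->
  cmeasurable (fun x => (\1_A x)%:C).
Proof. by move=> mA; split; [exact: measurable_indic|exact: measurable_cst]. Qed.

Lemma cmeasurable_comp phi (h : 'rV[R]_n -> 'rV[R]_n) : cmeasurable phi ->
  measurable_fun [set: 'rV[R]_n] h -> cmeasurable (fun x => phi (h x)).
Proof.
by move=> [rp ip] mh; split; [exact: (measurableT_comp rp)|exact:
  (measurableT_comp ip)].
Qed.

Lemma cintegrable_le phi (h : 'rV[R]_n -> R) : cmeasurable phi ->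
  mu.-integrable setT (fun x => (h x)%:E) -> (forall x, cabs (phi x) <= h x) ->
  cintegrable phi.
Proof.
move=> [rp ip] ih H; split; apply: le_integrable ih => //.
- exact/measurable_EFinP.
- move=> x _ /=; rewrite lee_fin (le_trans (Re_le_cabs _))// (le_trans (H x))//.
  exact: ler_norm.
- exact/measurable_EFinP.
- move=> x _ /=; rewrite lee_fin (le_trans (Im_le_cabs _))// (le_trans (H x))//.
  exact: ler_norm.
Qed.

(** The factor 2 comes from estimating the real and imaginary parts separately. *)
Lemma cabs_cintegral_le phi (h : 'rV[R]_n -> R) : cmeasurable phi ->
  mu.-integrable setT (fun x => (h x)%:E) -> (forall x, cabs (phi x) <= h x) ->
  cabs (cintegral phi) <= 2 * \int[mu]_x h x.
Proof.
move=> mp ih H; have [rp ip] := cintegrable_le mp ih H.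
rewrite mulr_natl mulr2n (le_trans (cabs_le_ReIm _))//= lerD//.
- rewrite (le_trans (le_normr_Rintegral _ _))// le_Rintegral//.
    exact: (integrable_norm rp).
  by move=> x _; rewrite (le_trans (Re_le_cabs _)).
- rewrite (le_trans (le_normr_Rintegral _ _))// le_Rintegral//.
    exact: (integrable_norm ip).
  by move=> x _; rewrite (le_trans (Im_le_cabs _)).
Qed.

Lemma cintegralB phi psi : cintegrable phi -> cintegrable psi ->
  cintegral (fun x => phi x - psi x) = cintegral phi - cintegral psi.
Proof.
move=> [rp ip] [rq iq]; rewrite /cintegral.
under eq_Rintegral do rewrite raddfB/=.
rewrite RintegralB//.
under [X in _ +i* X]eq_Rintegral do rewrite raddfB/=.
by rewrite RintegralB.
Qed.

Lemma Re_scaleM (c : R[i]) phi x :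
  complex.Re (c * phi x) =
    complex.Re c * complex.Re (phi x) - complex.Im c * complex.Im (phi x).
Proof. by case: c (phi x) => a b [e f]. Qed.

Lemma Im_scaleM (c : R[i]) phi x :
  complex.Im (c * phi x) =
    complex.Re c * complex.Im (phi x) + complex.Im c * complex.Re (phi x).
Proof. by case: c (phi x) => a b [e f]. Qed.

Lemma cintegrableZ (c : R[i]) phi : cintegrable phi ->
  cintegrable (fun x => c * phi x).
Proof.
move=> [rp ip]; split.
- under eq_fun do rewrite Re_scaleM EFinB !EFinM.
  by apply: integrableB => //; exact: integrableZl.
- under eq_fun do rewrite Im_scaleM EFinD !EFinM.
  by apply: integrableD => //; exact: integrableZl.
Qed.

Lemma cintegralZ (c : R[i]) phi : cintegrable phi ->
  cintegral (fun x => c * phi x) = c * cintegral phi.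
Proof.
move=> [rp ip]; rewrite /cintegral.
have Z (e : R) h : mu.-integrable setT (fun x => (h x)%:E) ->
  mu.-integrable setT (fun x => (e * h x)%:E).
  by move=> ih; exact: (integrableZl _ e ih).
under eq_Rintegral do rewrite Re_scaleM.
under [X in _ +i* X]eq_Rintegral do rewrite Im_scaleM.
rewrite RintegralB//; [|exact: Z..].
rewrite RintegralD//; [|exact: Z..].
by rewrite !RintegralZl//; case: c => a b; simpc.
Qed.

End complex_integral.

(** * Schwartz functions *)

Section schwartz_facts.
Context {R : realType} {n : nat}.
Implicit Types (f : 'rV[R]_n -> R) (phi : 'rV[R]_n -> R[i]).

(** Mean value theorem along the segment from [x] to [y]: the derivative in the
direction y - x is the sum of n partial derivatives weighted by coordinates. *)
Lemma lipschitz_of_partials f (M : R) :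
  (forall x, differentiable f x) ->
  (forall i x, `|'D_(delta_mx ord0 i) f x| <= M) ->
  forall x y, `|f y - f x| <= n%:R * M * `|y - x|.
Proof.
move=> df dM x y; set v := y - x.
have Dv p : `|'D_v f p| <= n%:R * M * `|v|.
  rewrite deriveE// [X in 'd f p X]row_sum_delta raddf_sum/=.
  rewrite (le_trans (ler_norm_sum _ _ _))//.
  apply: (@le_trans _ _ (\sum_(i < n) M * `|v|)); last first.
    by rewrite sumr_const card_ord -mulrA mulr_natl.
  apply: ler_sum => i _; rewrite linearZ/= normrM mulrC.
  by rewrite ler_pM// ?coord_le_norm// -deriveE.
pose h (t : R) := f (x + t *: v).
(* The difference quotients of h at t are those of f at x + t v along v. *)
have quot t : (fun e : R => e^-1 *: (h (e *: 1 + t) - h t)) = (fun e =>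
  e^-1 *: (f (e *: v + (x + t *: v)) - f (x + t *: v))).
  apply/funext => e; rewrite /h; congr (_ *: (f _ - _)).
  by rewrite -[e *: 1]/(e * 1) mulr1 scalerDl addrCA.
have dh t : is_derive t (1 : R) h ('D_v f (x + t *: v)).
  split; last by rewrite /derive [in LHS]quot.
  have := @diff_derivable _ _ _ f (x + t *: v) v (df _).
  by rewrite /derivable quot.
have [t _ ht] : exists2 c, c \in `]0, 1[%R & h 1 - h 0
  = 'D_v f (x + c *: v) * (1 - 0).
  apply: MVT => //.
  apply: continuous_subspaceT => t.
  by apply: differentiable_continuous; apply/derivable1_diffP.
move: ht; rewrite /h scale1r scale0r addr0 subr0 mulr1 /v subrKC => ->.
exact: Dv.
Qed.

Lemma schwartz_decay phi (s : seq 'I_n) (N : nat) : schwartz phi ->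
  (size s <= N)%N ->
  exists K, 0 <= K /\ forall x, (1 + `|x|) ^+ N * cabs (cpartial s phi x) <= K.
Proof.
move=> [_ _ /(_ N) fin] sN.
have bnd x : ((((1 + `|x|) ^+ N * cabs (cpartial s phi x))%:E)
  <= schwartz_seminorm N phi)%E.
  by apply: ereal_sup_ubound; exists (s, x).
have fn : schwartz_seminorm N phi \is a fin_num.
  rewrite ge0_fin_numE//; apply: le_trans (bnd 0).
  by rewrite lee_fin mulr_ge0 ?cabs_ge0 ?exprn_ge0 ?addr_ge0.
exists (fine (schwartz_seminorm N phi)).
have H x : (1 + `|x|) ^+ N * cabs (cpartial s phi x)
  <= fine (schwartz_seminorm N phi).
  by rewrite -lee_fin fineK.
split => //; apply: le_trans (H 0).
by rewrite mulr_ge0 ?cabs_ge0 ?exprn_ge0 ?addr_ge0.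
Qed.

Lemma cpartial0 phi x : cpartial [::] phi x = phi x.
Proof. by rewrite /cpartial/=; case: (phi x). Qed.

Lemma schwartz_Re_continuous phi : schwartz phi ->
  continuous (fun x => complex.Re (phi x)).
Proof. by move=> [sR _ _] x; apply: differentiable_continuous;
  exact: (sR [::]). Qed.

Lemma schwartz_Im_continuous phi : schwartz phi ->
  continuous (fun x => complex.Im (phi x)).
Proof. by move=> [_ sI _] x; apply: differentiable_continuous;
  exact: (sI [::]). Qed.

Lemma schwartz_cmeasurable phi : schwartz phi -> cmeasurable phi.
Proof.
by move=> sp; split; apply: measurable_continuous;
  [exact: schwartz_Re_continuous|exact: schwartz_Im_continuous].
Qed.

(** The first moment of a Schwartz function controls every error term below. *)
Lemma schwartz_integrable phi : schwartz phi ->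
  (lebesgue_Rd n).-integrable setT (fun u => ((1 + `|u|) * cabs (phi u))%:E).
Proof.
move=> sp; have [K [K0 HK]] := @schwartz_decay phi [::] n.+2 sp isT.
apply: (@integrable_decay _ _ (fun u => (1 + `|u|) * cabs (phi u)) K).
  apply: measurable_funM; last exact: (measurable_cabs (schwartz_cmeasurable sp)).
  apply: measurable_funD => //.
  by apply: measurable_continuous; exact: norm_continuous.
move=> u; rewrite ger0_norm ?mulr_ge0 ?cabs_ge0 ?addr_ge0//.
by rewrite mulrA -exprSr; have := HK u; rewrite cpartial0.
Qed.

Lemma schwartz_bounded phi : schwartz phi -> exists K, forall x, cabs (phi x) <= K.
Proof.
move=> sp; have [K [K0 HK]] := @schwartz_decay phi [::] 0 sp isT.
by exists K => x; have := HK x; rewrite expr0 mul1r cpartial0.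
Qed.

Lemma schwartz_lipschitz phi : schwartz phi ->
  exists L, 0 <= L /\ forall x y, cabs (phi y - phi x) <= L * `|y - x|.
Proof.
move=> sp; case: (sp) => sR sI _.
have /choice[K HK] i := @schwartz_decay phi [:: i] 1 sp isT.
pose M := \sum_(i < n) K i.
have M0 : 0 <= M by apply: sumr_ge0 => i _; have [] := HK i.
have KM i x : cabs (cpartial [:: i] phi x) <= M.
  have [K0 /(_ x)] := HK i.
  rewrite expr1 => H; apply: (@le_trans _ _ (K i)).
    by rewrite (le_trans _ H)// ler_peMl ?cabs_ge0// lerDl.
  rewrite /M (bigD1 i)//= lerDl sumr_ge0// => j _; by have [] := HK j.
exists (2 * (n%:R * M)); split; first by rewrite !mulr_ge0.
move=> x y; rewrite (le_trans (cabs_le_ReIm _))//.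
rewrite (_ : 2 * _ * _ = n%:R * M * `|y - x| + n%:R * M * `|y - x|); last by ring.
rewrite lerD// raddfB/=.
- apply: (@lipschitz_of_partials (fun x => complex.Re (phi x))) => [z|i z];
  first exact: (sR [::]).
  by rewrite (le_trans _ (KM i z))// (le_trans _ (Re_le_cabs _)).
- apply: (@lipschitz_of_partials (fun x => complex.Im (phi x))) => [z|i z];
  first exact: (sI [::]).
  by rewrite (le_trans _ (KM i z))// (le_trans _ (Im_le_cabs _)).
Qed.

End schwartz_facts.

(** * Averages against a dilated kernel *)

Section affine_integral.
Context {R : realType} {n : nat}.
Local Notation mu := (@lebesgue_Rd R n).
Variables (x : 'rV[R]_n) (s : R).
Hypothesis s0 : 0 < s.
Local Notation eta := (fun u : 'rV[R]_n => x - s *: u).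

(** Change of variables y = x - s u. *)
Lemma ge0_integral_affine (f : 'rV[R]_n -> \bar R) :
  measurable_fun setT f -> (forall y, 0 <= f y)%E ->
  (\int[mu]_y f y = (s ^+ n)%:E * \int[mu]_u f (eta u))%E.
Proof.
move=> mf f0.
pose m := mscale (NngNum (exprn_ge0 n (ltW s0)))
  (measure_function_pushforward__canonical__measure_function_Measure
    mu (measurable_affine x s)).
rewrite (eq_measure_integral m); last first.
  by move=> A mA _; exact: lebesgue_Rd_affine.
rewrite ge0_integral_mscale//; congr (_ * _)%E.
by rewrite ge0_integral_pushforward//; exact: measurable_affine.
Qed.

Lemma integrable_affine (h : 'rV[R]_n -> R) :
  measurable_fun setT (h : _ -> measurableTypeR R) ->
  mu.-integrable setT (fun u => (h (eta u))%:E) ->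
  mu.-integrable setT (fun y => (h y)%:E).
Proof.
move=> mh /integrableP[_ ih]; apply/integrableP; split;
  first exact/measurable_EFinP.
rewrite ge0_integral_affine//; last by apply: measurableT_comp => //;
  exact/measurable_EFinP.
move: ih; set I := (\int[mu]_u _)%E; move=> ih.
by rewrite lte_mul_pinfty// lee_fin exprn_ge0// ltW.
Qed.

Lemma Rintegral_affine (h : 'rV[R]_n -> R) :
  measurable_fun setT (h : _ -> measurableTypeR R) ->
  mu.-integrable setT (fun u => (h (eta u))%:E) ->
  \int[mu]_y h y = s ^+ n * \int[mu]_u h (eta u).
Proof.
move=> mh ih.
have mh' : measurable_fun setT (fun y => (h y)%:E) by exact/measurable_EFinP.
have fm := integrable_fin_num measurableT ih.
rewrite /Rintegral -[RHS]/(fine (s ^+ n)%:E * _) -fineM//; congr fine.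
rewrite [in LHS]integralE.
rewrite ge0_integral_affine//; last exact: measurable_funepos.
rewrite [X in (_ - X)%E]ge0_integral_affine//; last exact: measurable_funeneg.
have distr (c : R) (I a b : \bar R) : I = (a - b)%E -> (a +? - b)%E ->
  (c%:E * I = c%:E * a - c%:E * b)%E.
  by move=> -> ab; rewrite muleBr.
rewrite (distr _ _ _ _ (integralE _ _ _) (integrable_add_def measurableT ih)).
by congr (_ * _ - _ * _)%E; apply: eq_integral => u _; rewrite ?funeposE ?funenegE.
Qed.

Lemma cintegrable_affine (phi : 'rV[R]_n -> R[i]) : cmeasurable phi ->
  cintegrable (fun u => phi (eta u)) -> cintegrable phi.
Proof. by move=> [rp ip] [ir ii]; split; exact: integrable_affine. Qed.

Lemma cintegral_affine (phi : 'rV[R]_n -> R[i]) : cmeasurable phi ->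
  cintegrable (fun u => phi (eta u)) ->
  cintegral phi = (s ^+ n)%:C * cintegral (fun u => phi (eta u)).
Proof.
move=> [rp ip] [ir ii]; rewrite /cintegral.
rewrite (Rintegral_affine rp ir) (Rintegral_affine ip ii).
by simpc.
Qed.

End affine_integral.

Section averages.
Context {R : realType} {n : nat} (Phi : 'rV[R]_n -> R[i]).
Hypothesis sPhi : schwartz Phi.
Local Notation mu := (@lebesgue_Rd R n).
Implicit Types (w : 'rV[R]_n -> R[i]) (x : 'rV[R]_n).

Definition first_moment : R := \int[mu]_u ((1 + `|u|) * cabs (Phi u)).

Lemma first_moment_ge0 : 0 <= first_moment.
Proof. by apply: Rintegral_ge0 => u _; rewrite mulr_ge0 ?cabs_ge0 ?addr_ge0. Qed.

(** Errors are functions of linear growth with a small constant [e]; integrating them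
against the kernel costs only its first moment. *)
Lemma weighted_integral w (e : R) : cmeasurable w ->
  (forall u, cabs (w u) <= e * (1 + `|u|)) ->
  cintegrable (fun u => w u * Phi u) /\
  cabs (cintegral (fun u => w u * Phi u)) <= 2 * (e * first_moment).
Proof.
move=> mw we.
have mP := cmeasurableM mw (schwartz_cmeasurable sPhi).
have ih := integrableZl measurableT e (schwartz_integrable sPhi).
have le u : cabs (w u * Phi u) <= e * ((1 + `|u|) * cabs (Phi u)).
  by rewrite cabsM mulrA ler_wpM2r ?cabs_ge0.
split; first exact: (cintegrable_le mP ih).
apply: le_trans (cabs_cintegral_le mP ih le) _.
by rewrite RintegralZl//; exact: schwartz_integrable.
Qed.

(** The convolution of [w] with the kernel dilated to scale 2^-k. *)
Definition average k w x : R[i] := cintegral (fun y => w y * dilate k Phi (x - y)).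

Lemma bounded_weight w (B : R) (h : 'rV[R]_n -> 'rV[R]_n) :
  (forall y, cabs (w y) <= B) -> forall u, cabs (w (h u)) <= B * (1 + `|u|).
Proof.
move=> wB u; rewrite (le_trans (wB _))// ler_peMr ?lerDl//.
exact: le_trans (cabs_ge0 _) (wB 0).
Qed.

Lemma dilate_affine k w x u :
  w (x - 2 ^- k *: u) * dilate k Phi (x - (x - 2 ^- k *: u)) =
  (2 ^+ (k * n))%:C * (w (x - 2 ^- k *: u) * Phi u).
Proof.
rewrite /dilate subKr scalerA divff ?expf_neq0// scale1r.
by rewrite rmorphXn/= !rmorphD/= mulrCA.
Qed.

Lemma cmeasurable_dilate k x : cmeasurable (fun y => dilate k Phi (x - y)).
Proof.
apply: cmeasurableM; first exact: cmeasurable_cst.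
apply: (cmeasurable_comp (phi := fun v => Phi (2 ^+ k *: v)) (h := fun y => x - y)).
  apply: (cmeasurable_comp (phi := Phi) (h := fun v => 2 ^+ k *: v)).
    exact: schwartz_cmeasurable.
  have := measurable_affine 0 (- 2 ^+ k : R) (n := n).
  by apply: eq_measurable_fun => v _; rewrite scaleNr opprK add0r.
have := measurable_affine x 1 (n := n).
by apply: eq_measurable_fun => v _; rewrite scale1r.
Qed.

Lemma average_integrable k w x (B : R) : cmeasurable w ->
  (forall y, cabs (w y) <= B) ->
  cintegrable (fun y => w y * dilate k Phi (x - y)).
Proof.
move=> mw wB.
apply: (@cintegrable_affine _ _ x (2 ^- k)); first by rewrite invr_gt0 exp2_gt0.
  by apply: cmeasurableM => //; exact: cmeasurable_dilate.
under eq_fun do rewrite dilate_affine.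
apply: cintegrableZ.
have mw' : cmeasurable (fun u => w (x - 2 ^- k *: u)).
  by apply: cmeasurable_comp => //; exact: measurable_affine.
by have [] := weighted_integral mw' (@bounded_weight _ _ (fun u =>
  x - 2 ^- k *: u) wB).
Qed.

(** Substituting y = x - 2^-k u moves the dilation from the kernel to the function,
where the limit at fine scales is visible. *)
Lemma averageE k w x (B : R) : cmeasurable w -> (forall y, cabs (w y) <= B) ->
  average k w x = cintegral (fun u => w (x - 2 ^- k *: u) * Phi u).
Proof.
move=> mw wB.
have mw' : cmeasurable (fun u => w (x - 2 ^- k *: u)).
  by apply: cmeasurable_comp => //; exact: measurable_affine.
have [int _] := weighted_integral mw' (@bounded_weight _ _ (fun u =>
  x - 2 ^- k *: u) wB).
have s0 : 0 < 2 ^- k :> R by rewrite invr_gt0 exp2_gt0.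
rewrite /average (cintegral_affine (x := x) s0); last 2 first.
- by apply: cmeasurableM => //; exact: cmeasurable_dilate.
- under eq_fun do rewrite dilate_affine.
  exact: cintegrableZ.
under eq_fun do rewrite dilate_affine.
rewrite cintegralZ// mulrA -rmorphM/= exprVn -exprM mulVf ?expf_neq0//.
by rewrite mul1r.
Qed.

(** A function that looks like [winf] when magnified 2^k times about [x], up to an
error of linear growth, has about the same average as [winf] at scale 1. *)
Lemma average_approx k w winf x (B C e : R) :
  cmeasurable w -> (forall y, cabs (w y) <= B) ->
  cmeasurable winf -> (forall u, cabs (winf u) <= C) ->
  (forall u, cabs (w (x - 2 ^- k *: u) - winf u) <= e * (1 + `|u|)) ->
  cabs (average k w x - cintegral (fun u => winf u * Phi u))
    <= 2 * (e * first_moment).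
Proof.
move=> mw wB mi iC H; rewrite (averageE _ _ mw wB).
have mw' : cmeasurable (fun u => w (x - 2 ^- k *: u)).
  by apply: cmeasurable_comp => //; exact: measurable_affine.
have [int _] := weighted_integral mw' (@bounded_weight _ _ (fun u =>
  x - 2 ^- k *: u) wB).
have [inti _] := weighted_integral mi (@bounded_weight _ _ id iC).
rewrite -cintegralB//.
under eq_fun do rewrite -mulrBl.
by have [] := weighted_integral (cmeasurableB mw' mi) H.
Qed.

(** The block kernels telescope. *)
Lemma LP_block_average k w x (B : R) : cmeasurable w ->
  (forall y, cabs (w y) <= B) ->
  LP_block Phi k.+1 (dist_of_fun w) x = average k.+1 w x - average k w x.
Proof.
move=> mw wB; rewrite /LP_block /dist_of_fun /LP_block_kernel /average.
under eq_fun do rewrite mulrBr.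
by rewrite cintegralB//; exact: average_integrable.
Qed.

End averages.

(** * The half-space profile of the kernel *)

Section half_space_profile.
Context {R : realType} {n : nat} (Phi : 'rV[R]_n -> R[i]) (i0 : 'I_n).
Hypothesis sPhi : schwartz Phi.
Local Notation mu := (@lebesgue_Rd R n).
Implicit Types (A B N : set 'rV[R]_n) (t : R).

Definition kernel_mass A : R := \int[mu]_u (\1_A u * cabs (Phi u)).

Lemma cabs_integrable : mu.-integrable setT (fun u => (cabs (Phi u))%:E).
Proof.
apply: le_integrable (schwartz_integrable sPhi) => //.
  by apply/measurable_EFinP; exact: (measurable_cabs (schwartz_cmeasurable sPhi)).
move=> u _ /=; rewrite lee_fin !ger0_norm ?mulr_ge0 ?cabs_ge0 ?addr_ge0//.
by rewrite ler_peMl ?cabs_ge0// lerDl.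
Qed.

Lemma kernel_mass_measurable A : measurable A ->
  measurable_fun setT (fun u => \1_A u * cabs (Phi u) : measurableTypeR R).
Proof.
move=> mA; apply: measurable_funM; first exact: measurable_indic.
exact: (measurable_cabs (schwartz_cmeasurable sPhi)).
Qed.

Lemma kernel_mass_integrable A : measurable A ->
  mu.-integrable setT (fun u => (\1_A u * cabs (Phi u))%:E).
Proof.
move=> mA; apply: le_integrable cabs_integrable => //.
  by apply/measurable_EFinP; exact: kernel_mass_measurable.
move=> u _ /=; rewrite lee_fin !ger0_norm ?mulr_ge0 ?cabs_ge0 ?addr_ge0//.
by rewrite ler_piMl ?cabs_ge0// indicE lern1 leq_b1.
Qed.

Lemma cutoff_integrable A : measurable A ->
  cintegrable (fun u => (\1_A u)%:C * Phi u).
Proof.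
move=> mA; apply: (cintegrable_le _ (kernel_mass_integrable mA)).
  apply: cmeasurableM; [exact: cmeasurable_indic|exact: schwartz_cmeasurable].
by move=> u; rewrite cabsM cabs_real ger0_norm.
Qed.

Lemma cabs_cutoff_le A B : measurable A -> measurable B -> B `<=` A ->
  cabs (cintegral (fun u => (\1_B u)%:C * Phi u)) <= 2 * kernel_mass A.
Proof.
move=> mA mB BA; apply: (cabs_cintegral_le _ (kernel_mass_integrable mA)).
  apply: cmeasurableM; [exact: cmeasurable_indic|exact: schwartz_cmeasurable].
move=> u; rewrite cabsM cabs_real ger0_norm// ler_wpM2r ?cabs_ge0//.
rewrite !indicE ler_nat; have [uB|//] := boolP (u \in B).
by rewrite mem_set//; exact/BA/set_mem.
Qed.

(** Dominated convergence. The null set [N] allows for sets that shrink to a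
hyperplane instead of shrinking to the empty set. *)
Lemma kernel_mass_vanishes (A : (set 'rV[R]_n)^nat) N (e : R) :
  (forall k, measurable (A k)) -> measurable N -> mu N = 0%E ->
  (forall u, ~ N u -> \forall k \near \oo, ~ A k u) -> 0 < e ->
  exists k, 2 * kernel_mass (A k) <= e.
Proof.
move=> mA mN N0 AN e0.
pose f k u := (\1_(A k) u * cabs (Phi u))%:E.
have f0 : {ae mu, forall u, setT u -> f k u @[k --> \oo] --> (cst 0%E : _ ->
  \bar R) u}.
  exists N; split => // u /= Hu; apply: contrapT => Nu; apply: Hu => _.
  apply: cvg_near_cst; have := AN u Nu; apply: filterS => k Au.
  by rewrite /f indicE memNset// mul0r.
have fle : {ae mu, forall u k, setT u -> (`|f k u| <= (cabs (Phi u))%:E)%E}.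
  apply: aeW => u k _ /=; rewrite lee_fin ger0_norm ?mulr_ge0 ?cabs_ge0//.
  by rewrite ler_piMl ?cabs_ge0// indicE lern1 leq_b1.
have mf k : measurable_fun setT (f k) by exact: (measurable_int _
  (kernel_mass_integrable (mA k))).
have [_ _] := dominated_convergence measurableT mf
  (measurable_cst _) f0 cabs_integrable fle.
rewrite integral0 => /fine_cvgP[_ /cvgrPdist_le/(_ _ (divr_gt0 e0
  (ltr0n R 2)))[k _ Hk]].
exists k; have := Hk k (leqnn _).
rewrite sub0r normrN /= -/(kernel_mass (A k)) => /(le_trans (ler_norm _)).
by rewrite ler_pdivlMr// mulrC.
Qed.

Definition half_space t : set 'rV[R]_n := [set u | t < u ord0 i0].

Definition slab s t : set 'rV[R]_n := [set u | s < u ord0 i0 <= t].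

Lemma measurable_half_space t : measurable (half_space t).
Proof.
rewrite (_ : half_space t = (fun u => u ord0 i0) @^-1` `]t, +oo[%classic).
  by rewrite -[X in measurable X]setTI; apply: measurable_coord.
by apply/seteqP; split => u /=; rewrite in_itv/= andbT.
Qed.

Lemma measurable_slab s t : measurable (slab s t).
Proof.
rewrite (_ : slab s t = (fun u => u ord0 i0) @^-1` `]s, t]%classic).
  by rewrite -[X in measurable X]setTI; apply: measurable_coord.
by apply/seteqP; split => u /=; rewrite in_itv/=.
Qed.

(** The function P of the introduction. *)
Definition profile t : R[i] :=
  cintegral (fun u => (\1_(half_space t) u)%:C * Phi u).

Lemma profileB s t : s <= t ->
  profile s - profile t = cintegral (fun u => (\1_(slab s t) u)%:C * Phi u).
Proof.
move=> st; rewrite /profile -cintegralB; [|by apply: cutoff_integrable;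
  exact: measurable_half_space..].
congr cintegral; apply/funext => u; rewrite -mulrBl -rmorphB/=; congr (_%:C * _).
rewrite !indicE.
have [us|us] := ltP s (u ord0 i0); have [ut|ut] := ltP t (u ord0 i0).
- by rewrite mem_set// mem_set// memNset ?subrr//= /slab/= => /andP[_];
  rewrite leNgt ut.
- rewrite mem_set// memNset ?mem_set ?subr0//= /slab/= ?us//.
  by rewrite /half_space/=; apply/negP; rewrite -leNgt.
- by have := lt_le_trans ut (le_trans us st); rewrite ltxx.
- rewrite !memNset ?subr0//= /slab /half_space/=; try by apply/negP; rewrite -leNgt.
  by move=> /andP[]; rewrite ltNge us.
Qed.

(** The slabs ]t, t + 1/(k+1)], open on the left, shrink to the empty set. *)
Lemma profile_right_continuous t (e : R) : 0 < e ->
  exists2 dl, 0 < dl & forall s, t <= s <= t + dl ->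
    cabs (profile t - profile s) <= e.
Proof.
move=> e0.
have [||||k Hk] := @kernel_mass_vanishes (fun k =>
  slab t (t + k.+1%:R^-1)) set0 e _ _ _ _ e0.
- by move=> k; exact: measurable_slab.
- exact: measurable0.
- exact: measure0.
- move=> u _; have [ut|ut] := leP (u ord0 i0) t.
    by apply: nearW => k; rewrite /slab/= => /andP[]; rewrite ltNge ut.
  near=> k; rewrite /slab/= => /andP[_]; apply/negP; rewrite -ltNge -ltrBrDl.
  rewrite invf_plt ?posrE// ?subr_gt0//.
  apply: (@lt_le_trans _ _ k%:R); last by rewrite ler_nat.
  by near: k; exact: nbhs_infty_gtr.
exists k.+1%:R^-1 => [|s /andP[ts sk]]; first by rewrite invr_gt0.
rewrite profileB//; apply: le_trans Hk.
apply: cabs_cutoff_le; [exact: measurable_slab|exact: measurable_slab|].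
by move=> u; rewrite /slab/= => /andP[-> /le_trans ->].
Unshelve. all: by end_near. Qed.

Hypothesis Phi1 : cintegral Phi = 1.

Definition hyperplane : set 'rV[R]_n := [set u | u ord0 i0 = 0].

Lemma hyperplane_null : mu hyperplane = 0%E.
Proof.
rewrite (_ : hyperplane = box (fun i => if i == i0 then [set 0] else setT)).
  rewrite lebesgue_Rd_box; last by move=> i; case: ifP.
  by rewrite (bigD1 i0)//= eqxx lebesgue_measure_set1 mul0e.
apply/seteqP; split => u /= H.
  by move=> i; case: ifPn => // /eqP ->.
by have := H i0; rewrite eqxx.
Qed.

(** Invariance under t |-> t / 2 would give P (2^j t) = P t for every integer j.
Large j forces P 1 = 0 and P (-1) = 1, while for j going to -oo the
difference P (-2^j) - P (2^j) is the mass of a slab shrinking to a hyperplane. *)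
Lemma profile_not_dilation_invariant : exists t, profile t - profile (t / 2) != 0.
Proof.
apply: contrapT => /forallNP H.
have {}H t : profile t = profile (t / 2).
  by apply/eqP; rewrite -subr_eq0; apply/negPn/negP; exact: H.
have Hk k t : profile (2 ^+ k * t) = profile t.
  elim: k => [|k IH]; first by rewrite expr0 mul1r.
  by rewrite H -IH exprS; congr profile; field.
have HVk k t : profile (2 ^- k * t) = profile t.
  by rewrite -(Hk k) mulrA divff ?expf_neq0// mul1r.
have small (z : R[i]) : (forall e, 0 < e -> cabs z <= e) -> z = 0.
  move=> Hz; apply/eqP/negPn/negP => /cabs_gt0 z0.
  have := Hz (cabs z / 2) (divr_gt0 z0 (ltr0n R 2)); lra.
have P1 : profile 1 = 0.
  apply: small => e e0.
  have [||||k He] := @kernel_mass_vanishes (fun k =>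
    half_space (2 ^+ k)) set0 e _ _ _ _ e0.
  - by move=> k; exact: measurable_half_space.
  - exact: measurable0.
  - exact: measure0.
  - move=> u _; near=> k; apply/negP; rewrite -leNgt (le_trans _
    (natr_le_exp2 k))// ltW//.
    by near: k; exact: nbhs_infty_gtr.
  rewrite -(Hk k) mulr1; apply: le_trans He.
  by apply: cabs_cutoff_le => //; exact: measurable_half_space.
have PN1 : 1 - profile (-1) = 0.
  apply: small => e e0.
  have [||||k He] := @kernel_mass_vanishes (fun k =>
    ~` half_space (- 2 ^+ k)) set0 e _ _ _ _ e0.
  - by move=> k; apply: measurableC; exact: measurable_half_space.
  - exact: measurable0.
  - exact: measure0.
  - move=> u _; near=> k; apply; rewrite /half_space/= ltrNl (lt_le_trans _
    (natr_le_exp2 k))//.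
    by near: k; exact: nbhs_infty_gtr.
  rewrite -(Hk k) mulrN1; apply: le_trans He.
  rewrite -Phi1 /profile.
  have mh := measurable_half_space (- 2 ^+ k).
  rewrite (_ : cintegral Phi = cintegral (fun u => (\1_setT u)%:C * Phi u));
    last first.
    by congr cintegral; apply/funext => u; rewrite indicE in_setT mul1r.
  rewrite -cintegralB; [|exact: cutoff_integrable..].
  rewrite (_ : (fun _ => _) = (fun u => (\1_(~` half_space
    (- 2 ^+ k)) u)%:C * Phi u)).
    by apply: cabs_cutoff_le => //; exact: measurableC.
  apply/funext => u; rewrite -mulrBl -rmorphB/=; congr (_%:C * _).
  by rewrite !indicE in_setT in_setC; case: (_ \in _); rewrite ?subrr ?subr0.
have : profile (-1) - profile 1 = 0.
  apply: small => e e0.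
  have [||||k He] := @kernel_mass_vanishes (fun k =>
    slab (- 2 ^- k) (2 ^- k)) hyperplane e _ _ _ _ e0.
  - by move=> k; exact: measurable_slab.
  - rewrite (_ : hyperplane = (fun u => u ord0 i0) @^-1` [set 0])//.
    by rewrite -[X in measurable X]setTI; apply: measurable_coord.
  - exact: hyperplane_null.
  - move=> u /eqP u0; near=> k; rewrite /slab/= => /andP[H1 H2].
    have : `|u ord0 i0| <= 2 ^- k by rewrite ler_norml H2 ltW.
    apply/negP; rewrite -ltNge invf_plt ?posrE ?normr_gt0// ?exp2_gt0//.
    rewrite (lt_le_trans _ (natr_le_exp2 k))//.
    by near: k; exact: nbhs_infty_gtr.
  rewrite -(HVk k 1) -(HVk k (-1)) mulr1 mulrN1 profileB; last first.
    by rewrite (@le_trans _ _ 0)// ?oppr_le0 ?invr_ge0 ltW// exp2_gt0.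
  by apply: le_trans He; apply: cabs_cutoff_le => //; exact: measurable_slab.
rewrite P1 subr0 => PN0; move: PN1; rewrite PN0 subr0 => /eqP.
by rewrite oner_eq0.
Unshelve. all: by end_near. Qed.

Lemma profile_gap : exists t0 eta dl, [/\ 0 < eta, 0 < dl &
  forall t, t0 <= t <= t0 + dl -> eta <= cabs (profile t - profile (t / 2))].
Proof.
have quarters (c a b1 b2 : R) :
    c <= a + (b1 + b2) -> b1 <= c / 4 -> b2 <= c / 4 -> c / 2 <= a by lra.
have near (t t0 d1 d2 : R) : t0 <= t <= t0 + Num.min d1 d2 ->
    (t0 <= t <= t0 + d1) /\ (t0 / 2 <= t / 2 <= t0 / 2 + d2).
  have := ge_min d1 d1 d2; rewrite lexx/= => m1.
  have := ge_min d2 d1 d2; rewrite lexx orbT/= => m2.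
  by move=> /andP[h1 h2]; split; apply/andP; split; lra.
have [t0 /cabs_gt0 H0] := profile_not_dilation_invariant.
set c := cabs _ in H0.
have c4 : 0 < c / 4 by rewrite divr_gt0.
have [d1 d10 H1] := @profile_right_continuous t0 _ c4.
have [d2 d20 H2] := @profile_right_continuous (t0 / 2) _ c4.
exists t0, (c / 2), (Num.min d1 d2); split; first by rewrite divr_gt0.
  by rewrite lt_min d10.
move=> t /near[t1 t2]; apply: quarters (H1 _ t1) (H2 _ t2).
apply: le_trans (lerD (lexx _) (cabsB _ _)); apply: le_trans (cabsD _ _).
rewrite (_ : _ + _ = profile t0 - profile (t0 / 2)); first exact: lexx.
by move: (profile t0) (profile (t0 / 2)) (profile t) (profile (t / 2)) => *; ring.
Qed.

End half_space_profile.

(** * Haar polynomials: dyadic constancy and jumps *)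

Section haar_span.
Context {R : realType} {n : nat}.
Implicit Types (x y : 'rV[R]_n) (f : 'rV[R]_n -> R[i]).

(** The breakpoints 0, 1/2, 1 of [haar1] correspond to points of 2^-K Z as soon as
k < K, and rounding down to 2^-K Z preserves comparisons with such points. *)
Lemma dyadic_value_cmp (k K : nat) (m j : int) (t : R) : (k < K)%N ->
  (j%:~R / 2 <= 2 ^+ k * dyadic_value K t - m%:~R)
    = (j%:~R / 2 <= 2 ^+ k * t - m%:~R).
Proof.
move=> kK; have -> : K = (k + (K - k.+1).+1)%N by rewrite addnS -addSn subnKC.
set l := (K - k.+1)%N.
(* Scaled by 2^K, the breakpoint (j/2 + m) 2^-k becomes an integer. *)
have eqv s : (j%:~R / 2 <= 2 ^+ k * s - m%:~R)
  = (((j + 2 * m) * 2 ^+ l)%:~R <= 2 ^+ (k + l.+1) * s :> R).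
  rewrite exprD mulrAC exprS -[in RHS](@ler_pM2r _ (2 * 2 ^+ l)^-1);
    last by rewrite invr_gt0 mulr_gt0// exp2_gt0.
  rewrite mulfK ?mulf_neq0 ?expf_neq0// lerBrDr; congr (_ <= _).
  rewrite rmorphM rmorphD rmorphM/= rmorphXn/=; field.
  by rewrite expf_neq0.
rewrite !eqv /dyadic_value mulrCA divff ?expf_neq0// mulr1.
by rewrite ler_int -floor_ge_int.
Qed.

Lemma haar1E (e : bool) (t : R) : haar1 e t =
  if e then ((0 <= t) && (t < 2^-1))%:R - ((2^-1 <= t) && (t < 1))%:R
  else ((0 <= t) && (t < 1))%:R.
Proof. by rewrite /haar1; case: e; rewrite !indicE !mem_setE !in_itv. Qed.

Lemma haar1_dyadic (e : bool) (k K : nat) (m : int) (t : R) : (k < K)%N ->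
  haar1 e (2 ^+ k * dyadic_value K t - m%:~R) = haar1 e (2 ^+ k * t - m%:~R).
Proof.
move=> kK; rewrite !haar1E.
have := dyadic_value_cmp m 0 t kK; rewrite mul0r => E0.
have := dyadic_value_cmp m 1 t kK; rewrite mul1r => E1.
have := dyadic_value_cmp m 2 t kK; rewrite divff// => E2.
by rewrite !ltNge E0 E1 E2.
Qed.

Lemma haar_dyadic e k m K x : (k < K)%N -> haar e k m (dyadic_floor K x)
  = haar e k m x :> R[i].
Proof.
move=> kK; rewrite /haar; congr (_%:C); apply: eq_bigr => i _.
by rewrite mxE; exact: haar1_dyadic.
Qed.

Lemma haar1_le1 e (t : R) : `|haar1 e t| <= 1.
Proof.
rewrite haar1E; case: e; last by rewrite ger0_norm// lern1 leq_b1.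
have [t2|t2] := ltP t 2^-1.
  by rewrite andbT subr0 ger0_norm// lern1 leq_b1.
by rewrite andbF sub0r normrN ger0_norm// lern1 leq_b1.
Qed.

Lemma haar1_support e (t : R) : 1 <= t -> haar1 e t = 0.
Proof.
move=> t1; rewrite haar1E.
have -> : (t < 2^-1) = false by apply/negbTE; rewrite -leNgt; lra.
by rewrite ltNge t1 !andbF subrr; case: e.
Qed.

Lemma haar_le1 e k m x : cabs (haar e k m x : R[i]) <= 1.
Proof.
rewrite /haar cabs_real.
elim/big_rec : _ => [|i p _ p1]; first by rewrite normr1.
by rewrite normrM mulr_ile1 ?haar1_le1.
Qed.

(** A crude bound for the support in one direction, the same for every level [k]:
for nonnegative coordinates 2^k x_i is at least x_i. *)
Lemma haar_support e k (m : {ffun 'I_n -> int}) x i :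
  `|m i|%:~R + 1 <= x ord0 i -> haar e k m x = 0 :> R[i].
Proof.
move=> mx; rewrite /haar (bigD1 i)//= haar1_support ?mul0r//.
have xi : x ord0 i <= 2 ^+ k * x ord0 i.
  rewrite ler_peMl//; first by rewrite (le_trans _ mx)// addr_ge0// ler0z.
  by rewrite exprn_ege1// ler1n.
have : (m i)%:~R <= `|m i|%:~R :> R by rewrite ler_int ler_norm.
lra.
Qed.

Lemma cspan_haarP f : cspan haar_system f ->
  exists N (c : 'I_N -> R[i]) e k m, f = fun x =>
    \sum_(j < N) c j * haar (e j) (k j) (m j) x.
Proof.
move=> [N [c [h [Hh ->]]]].
have /choice[t Ht] j : exists t : {ffun 'I_n -> bool} * nat * {ffun 'I_n ->
  int}, h j = haar t.1.1 t.1.2 t.2.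
  have [[m _ <-]|[k [m [e [_ ->]]]]] := Hh j;
    first by exists ([ffun=> false], 0%N, m).
  by exists (e, k, m).
exists N, c, (fun j => (t j).1.1), (fun j => (t j).1.2), (fun j => (t j).2).
by apply/funext => x; apply: eq_bigr => j _; rewrite Ht.
Qed.

Lemma cspan_haar_dyadic f : cspan haar_system f ->
  exists K, forall x, f x = f (dyadic_floor K x).
Proof.
move=> /cspan_haarP[N [c [e [k [m ->]]]]].
exists (\max_(j < N) k j).+1 => x; apply: eq_bigr => j _;
  rewrite haar_dyadic// ltnS.
exact: leq_bigmax.
Qed.

Lemma cspan_haar_bounded f : cspan haar_system f ->
  exists B, forall x, cabs (f x) <= B.
Proof.
move=> /cspan_haarP[N [c [e [k [m ->]]]]].
exists (\sum_(j < N) cabs (c j)) => x.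
elim/big_ind2 : _ => [|z1 b1 z2 b2 h1 h2|j _]; first by rewrite cabs0.
  by rewrite (le_trans (cabsD _ _))// lerD.
by rewrite cabsM ler_piMr ?cabs_ge0// haar_le1.
Qed.

Lemma cspan_haar_support f i : cspan haar_system f ->
  exists M : R, forall x, M <= x ord0 i -> f x = 0.
Proof.
move=> /cspan_haarP[N [c [e [k [m ->]]]]].
exists (\sum_(j < N) (`|m j i|%:~R + 1)) => x Mx.
apply: big1 => j _; rewrite (@haar_support _ _ _ _ i) ?mulr0//.
by apply: le_trans Mx; rewrite [leRHS](bigD1 j)//= lerDl sumr_ge0//.
Qed.

Lemma cmeasurable_dyadic f K : (forall x, f x = f (dyadic_floor K x)) ->
  cmeasurable f.
Proof.
move=> fK; split.
  apply: eq_measurable_fun (measurable_step K (fun x => complex.Re (f x))) => x _.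
  by rewrite -fK.
apply: eq_measurable_fun (measurable_step K (fun x => complex.Im (f x))) => x _.
by rewrite -fK.
Qed.

(** Starting from the dyadic cube of [x] and moving up in the direction [i0], some
cube is the last one before [f] vanishes. The point [z] is the centre of its
upper face, and the ball of radius half a side meets only this cube and the next. *)
Lemma jump_face f K i0 (M : R) x : (forall y, f y = f (dyadic_floor K y)) ->
  (forall y, M <= y ord0 i0 -> f y = 0) -> f x != 0 ->
  exists z r v, [/\ 0 < r, v != 0 &
    forall y, `|y - z| < r -> f y = if y ord0 i0 < z ord0 i0 then v else 0].
Proof.
move=> fK fM fx.
pose q (w : 'I_n -> int) : 'rV[R]_n := \row_i ((w i)%:~R / 2 ^+ K).
have qP w y : (forall i, (w i)%:~R <= 2 ^+ K * y ord0 i < (w i + 1)%:~R) ->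
  f y = f (q w).
  move=> H; rewrite fK; congr f; apply/rowP => i; rewrite !mxE.
  by rewrite /dyadic_value (floor_def (H i)).
(* Z N is the integer index of the N-th cube of the walk, q (Z N) its corner. *)
pose Z (N : nat) (i : 'I_n) : int := Num.floor (2 ^+ K * x ord0 i) +
  (if i == i0 then N%:Z else 0).
have K0 : 0 < 2 ^+ K :> R := exp2_gt0 K.
have fZ0 : f (q (Z 0)) != 0.
  rewrite -(@qP (Z 0%N) x)// => i.
  by rewrite /Z; case: ifP => _; rewrite addr0 floor_itv.
have exN : exists N, f (q (Z N)) == 0.
  pose N := (Num.truncn (2 ^+ K * `|M - x ord0 i0 + 1|)).+2.
  exists N; rewrite fM// mxE /Z eqxx ler_pdivlMr//.
  have Nb : 2 ^+ K * `|M - x ord0 i0 + 1| < N.-1%:R := truncnS_gt _.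
  have fl := floorD1_gt (2 ^+ K * x ord0 i0).
  rewrite rmorphD/= -[N%:Z%:~R]/(N%:R : R).
  have : 2 ^+ K * (M - x ord0 i0 + 1) <= 2 ^+ K * `|M - x ord0 i0 + 1| by rewrite
    ler_pM2l// ler_norm.
  have -> : N%:R = N.-1%:R + 1 :> R by rewrite -natr1.
  move: Nb fl; rewrite rmorphD/=.
  by lra.
case: (ex_minnP exN) => -[/eqP fZ _|N /eqP fZN min];
  first by rewrite fZ eqxx in fZ0.
have fZN' : f (q (Z N)) != 0 by apply/negP => /min; rewrite ltnn.
(* In units of 2^-K: one side up in the direction i0, half a side elsewhere. *)
pose z : 'rV[R]_n := \row_i (((Z N i)%:~R +
  (if i == i0 then 1 else 2^-1)) / 2 ^+ K).
have r0 : 0 < (2 ^+ K)^-1 / 2 :> R by rewrite divr_gt0 ?invr_gt0.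
exists z, ((2 ^+ K)^-1 / 2), (f (q (Z N))); split => // y yz.
have yi i : (Z N i)%:~R + (if i == i0 then 1 else 2^-1) - 2^-1
  < 2 ^+ K * y ord0 i < (Z N i)%:~R + (if i == i0 then 1 else 2^-1) + 2^-1.
  have : `|y ord0 i - z ord0 i| < (2 ^+ K)^-1 / 2.
    by apply: le_lt_trans yz; have := coord_le_norm (y - z) i; rewrite !mxE.
  rewrite mxE; set w := (_%:~R + _).
  rewrite (_ : y ord0 i - w / 2 ^+ K = (2 ^+ K * y ord0 i - w) / 2 ^+ K);
    last by field; rewrite gt_eqF.
  rewrite (_ : (2 ^+ K)^-1 / 2 = 2^-1 / 2 ^+ K); last by rewrite mulrC.
  rewrite normrM normfV (gtr0_norm K0) ltr_pM2r ?invr_gt0// ltr_norml.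
  by move=> /andP[h1 h2]; apply/andP; split; lra.
have yz0 : (y ord0 i0 < z ord0 i0) = (2 ^+ K * y ord0 i0 < (Z N i0)%:~R + 1).
  by rewrite mxE eqxx ltr_pdivlMr// mulrC.
have ZS i : Z N.+1 i = Z N i + (if i == i0 then 1 else 0).
  by rewrite /Z; case: ifP => _; rewrite ?addr0// intS addrA addrAC.
have iR (w : int) : (w + 1)%:~R = w%:~R + 1 :> R by rewrite rmorphD.
rewrite yz0; case: ltP => y0; [|rewrite -fZN]; apply: qP => i; rewrite ?ZS iR.
  by have := yi i; case: (eqVneq i i0) => [->|_] /andP[h1 h2]; apply/andP;
    split; lra.
have := yi i; case: (eqVneq i i0) => [->|_] /andP[h1 h2]; last by rewrite addr0;
  apply/andP; split; lra.
by rewrite iR; apply/andP; split; lra.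
Qed.

End haar_span.

(** * Lower bounds for norms *)

Section norm_lower_bounds.
Import HBNNSimple.
Context {R : realType}.

(** The integral of a nonnegative function, measurable or not, is a supremum over
the simple functions below it, and c 1_A is one of them. *)
Lemma integral_lower_indic d (T : measurableType d) (mu : {measure set T -> \bar R})
    (A : set T) (c : R) (f : T -> \bar R) : measurable A -> 0 <= c ->
  (forall x, 0 <= f x)%E -> (forall x, A x -> (c%:E <= f x)%E) ->
  (c%:E * mu A <= \int[mu]_x f x)%E.
Proof.
move=> mA c0 f0 cf; rewrite ge0_integralTE//.
pose h := scale_nnsfun (indic_nnsfun R mA) c0.
have -> : (c%:E * mu A = sintegral mu h)%E.
  rewrite -integralT_nnsfun.
  rewrite /h/=.
  under eq_integral do rewrite EFinM.
  rewrite ge0_integralZl//; first by rewrite integral_indic// setIT.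
    by apply/measurable_EFinP; exact: measurable_indic.
  by move=> x _; rewrite lee_fin.
apply: ereal_sup_ubound; exists h => // x.
rewrite /h/= /mindic indicE; have [xA|xA] := boolP (x \in A); last by rewrite mulr0.
by rewrite mulr1; exact/cf/set_mem.
Qed.

(** As [inv_exponent +oo] is 0, one formula serves all exponents. At +oo the bound
holds because a set of positive measure is not contained in a null set. *)
Lemma Lp_norm_lower n (p : \bar R) (F : 'rV[R]_n ->
  R[i]) (A : set 'rV[R]_n) (c m : R) :
  (0 < p)%E -> measurable A -> lebesgue_Rd n A = m%:E -> 0 < m -> 0 < c ->
  (forall x, A x -> c <= cabs (F x)) ->
  ((c * m `^ (inv_exponent p))%:E <= Lp_norm p F)%E.
Proof.
move=> p0 mA Am m0 c0 cF; rewrite /Lp_norm unlock.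
case: p p0 => [r| |//] r0.
- rewrite lte_fin in r0.
  have -> : c * m `^ (inv_exponent r%:E) = (c `^ r * m) `^ r^-1.
    by rewrite powRM ?powR_ge0 ?ltW// -powRrM divff ?gt_eqF// powRr1// ltW.
  rewrite -poweR_EFin; apply: gt0_ler_poweR => //.
  + by rewrite invr_ge0 ltW.
  + by rewrite in_itv/= leey andbT lee_fin mulr_ge0 ?powR_ge0 ?ltW.
  + by rewrite in_itv/= leey andbT integral_ge0// => x _; rewrite poweR_ge0.
  rewrite EFinM -Am; apply: integral_lower_indic => //; first exact: powR_ge0.
    by move=> x; rewrite poweR_ge0.
  move=> x Ax; rewrite /= ger0_norm ?cabs_ge0// lee_fin ge0_ler_powR//;
    last exact: cF.
  + exact: ltW.
  + by rewrite nnegrE ltW.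
  + by rewrite nnegrE cabs_ge0.
- have muT : (m%:E <= lebesgue_Rd n [set: 'rV[R]_n])%E.
    by rewrite -Am; apply: le_measure; rewrite ?inE.
  rewrite (lt_le_trans _ muT) ?lte_fin// powRr0 mulr1.
  rewrite leNgt; apply/negP => lt.
  have [N [mN N0 sN]] := ess_sup_ge (lebesgue_Rd n) (abse \o (fun x =>
    (cabs (F x))%:E)).
  have : (lebesgue_Rd n A <= lebesgue_Rd n N)%E.
    apply: le_measure; rewrite ?inE// => x Ax; apply: sN => /= le.
    have := le_lt_trans le lt; rewrite ger0_norm ?cabs_ge0// lte_fin.
    by rewrite ltNge cF.
  by rewrite Am N0 lee_fin leNgt m0.
Qed.

(** The only null set of the counting measure is the empty set, so that an essential
bound is a bound. *)
Lemma Lnorm_counting_infty_ge (u : nat -> \bar R) k :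
  (u k <= Lnorm counting +oo u)%E.
Proof.
rewrite unlock.
have cge (N : set nat) : N k -> (1 <= counting N :> \bar R)%E.
  move=> Nk; rewrite -(_ : counting [set k] = 1%E).
    by apply: le_measure; rewrite ?inE// => _ ->.
  by rewrite /counting asboolT ?fset_set1 ?finmap.cardfs1//; exact: finite_set1.
rewrite (_ : (0 < _)%E = true); last by rewrite (lt_le_trans _ (cge setT I)).
apply: le_trans (lee_abs _) _.
rewrite leNgt; apply/negP => lt.
have [N [mN N0 sN]] := ess_sup_ge (@counting _ R) (abse \o u).
have : N k by apply: sN => /= le; have := le_lt_trans le lt; rewrite ltxx.
by move/cge; rewrite N0 lee_fin ler10.
Qed.

End norm_lower_bounds.

(** * The jump bounds the Besov norm from below *)

Section lower_bound.
Context {R : realType} {n : nat} (Phi : 'rV[R]_n -> R[i]).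
Hypothesis sPhi : schwartz Phi.
Hypothesis Phi1 : cintegral Phi = 1.
Local Notation M1 := (first_moment Phi).

Lemma exp2_archimedean (a b : R) : 0 < b -> exists K, forall k, (K <= k)%N ->
  a * 2 ^- k <= b.
Proof.
move=> b0; exists (Num.truncn (a / b)).+1 => k Kk.
rewrite ler_pdivrMr ?exp2_gt0// mulrC -ler_pdivrMr//.
apply: le_trans (natr_le_exp2 k); apply: le_trans (ltW (truncnS_gt _)) _.
by rewrite ler_nat.
Qed.

(** As Phi has integral 1, constants are reproduced, and [g] deviates from its value
at [x] by at most L 2^-k |u|. *)
Lemma smooth_average g (L : R) k x : schwartz g -> 0 <= L ->
  (forall x y, cabs (g y - g x) <= L * `|y - x|) ->
  cabs (average Phi k g x - g x) <= 2 * (L * 2 ^- k * M1).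
Proof.
move=> sg L0 gL; have [B gB] := schwartz_bounded sg.
rewrite -[in X in cabs (_ - X)](mulr1 (g x)) -Phi1 -cintegralZ; last first.
  exact: (cintegrable_le (schwartz_cmeasurable sPhi) (cabs_integrable sPhi)).
apply: (@average_approx _ _ _ sPhi k g (fun=> g x) x B B) => //.
- exact: schwartz_cmeasurable.
- move=> u; apply: le_trans (gL _ _) _.
  rewrite addrAC subrr add0r normrN normrZ ger0_norm ?invr_ge0 ?exprn_ge0//.
  by rewrite -mulrA ler_wpM2l// ler_wpM2l ?invr_ge0 ?exprn_ge0// lerDr.
Qed.

Section face.
Variables (f : 'rV[R]_n -> R[i]) (i0 : 'I_n) (z : 'rV[R]_n) (r : R).
Variables (v : R[i]) (B : R).
Hypothesis mf : cmeasurable f.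
Hypothesis fB : forall x, cabs (f x) <= B.
Hypothesis r0 : 0 < r.
Hypothesis fz : forall y, `|y - z| < r ->
  f y = if y ord0 i0 < z ord0 i0 then v else 0.

(** Magnified 2^k times about a point at height 2^-k t over the face, [f] is v times
the indicator of the half-space u_i0 > t as long as 2^-k |u| < r / 2. Beyond
that range the trivial bound is at most a multiple of 2^-k |u|. *)
Lemma face_average k x : `|x - z| <= r / 2 ->
  cabs (average Phi k f x - v * profile Phi i0 (2 ^+ k * (x ord0 i0 - z ord0 i0)))
    <= 2 * (2 * (B + cabs v) / r * 2 ^- k * M1).
Proof.
move=> xz; set t := 2 ^+ k * _.
have k0 : 0 < 2 ^+ k :> R := exp2_gt0 k.
have B0 : 0 <= B := le_trans (cabs_ge0 _) (fB 0).
have mh := measurable_half_space i0 t.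
have Bv0 : 0 <= B + cabs v by rewrite addr_ge0 ?cabs_ge0.
have bound_ge0 (u : 'rV[R]_n) : 0 <= 2 * (B + cabs v) / r * 2 ^- k * (1 + `|u|).
  by rewrite !mulr_ge0 ?invr_ge0 ?exprn_ge0 ?addr_ge0 ?cabs_ge0// ltW.
rewrite /profile -cintegralZ; last exact: cutoff_integrable.
under [X in cintegral X]eq_fun do rewrite mulrA.
have wv u : cabs (v * (\1_(half_space i0 t) u)%:C) <= cabs v.
  by rewrite cabsM cabs_real ler_piMr ?cabs_ge0// ger0_norm// indicE lern1 leq_b1.
apply: (@average_approx _ _ _ sPhi k f (fun u =>
  v * (\1_(half_space i0 t) u)%:C) x B (cabs v)) => //.
  apply: cmeasurableM; [exact: cmeasurable_cst|exact: cmeasurable_indic].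
move=> u.
have [ur|ur] := ltP (2 ^- k * `|u|) (r / 2).
  rewrite fz; last first.
    rewrite addrAC (le_lt_trans (ler_normB _ _))//.
    by rewrite normrZ ger0_norm ?invr_ge0 ?exprn_ge0//; lra.
  have -> : ((x - 2 ^- k *: u) ord0 i0 < z ord0 i0) = (u \in half_space i0 t).
    rewrite !mxE; apply/idP/idP => [H|/set_mem].
      apply/mem_set; rewrite /half_space/= /t -ltr_pdivlMl//; lra.
    by rewrite /half_space/= /t -ltr_pdivlMl// => H; lra.
  rewrite indicE; case: (_ \in _); rewrite ?mulr1 ?mulr0 subrr cabs0.
    exact: bound_ge0.
  exact: bound_ge0.
apply: le_trans (cabsB _ _) _; apply: le_trans (lerD (fB _) (wv u)) _.
rewrite (_ : _ * (1 + `|u|) = (B + cabs v) * ((2 ^- k * (1 + `|u|)) / (r / 2)));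
  last first.
  by field; rewrite !gt_eqF.
rewrite ler_peMr ?addr_ge0 ?cabs_ge0// ler_pdivlMr ?divr_gt0// mul1r.
by apply: le_trans ur _; rewrite ler_wpM2l ?invr_ge0 ?exprn_ge0// lerDr.
Qed.

(** The height of [x] over the face is 2^-(k+1) t, so the coarser average sees it as
2^-k (t / 2). *)
Lemma block_approx g : schwartz g -> exists C, forall k x, `|x - z| <= r / 2 ->
  let t := 2 ^+ k.+1 * (x ord0 i0 - z ord0 i0) in
  cabs (LP_block Phi k.+1 (dist_sub (dist_of_fun f) (dist_of_fun g)) x
        - v * (profile Phi i0 t - profile Phi i0 (t / 2))) <= C * 2 ^- k.
Proof.
move=> sg; have [L [L0 gL]] := schwartz_lipschitz sg.
have [Bg gB] := schwartz_bounded sg.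
have B0 : 0 <= B := le_trans (cabs_ge0 _) (fB 0).
set Cf := 2 * (B + cabs v) / r.
have Cf0 : 0 <= Cf by rewrite !mulr_ge0 ?invr_ge0 ?addr_ge0 ?cabs_ge0// ltW.
(* Two averages of f, each off by 2 Cf M1 2^-k, and two of g, each off by
   2 L M1 2^-k. *)
exists (4 * (Cf + L) * M1) => k x xz /=; set t := 2 ^+ k.+1 * _.
have -> : LP_block Phi k.+1 (dist_sub (dist_of_fun f) (dist_of_fun g)) x =
    (average Phi k.+1 f x - average Phi k f x) -
      (average Phi k.+1 g x - average Phi k g x).
  by rewrite -(LP_block_average sPhi k x mf fB) -(LP_block_average sPhi k x
    (schwartz_cmeasurable sg) gB).
have a1 := face_average k.+1 xz; have a2 := face_average k xz.
have b1 := smooth_average k.+1 x sg L0 gL; have b2 := smooth_average k x sg L0 gL.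
rewrite -/t in a1.
have tt : 2 ^+ k * (x ord0 i0 - z ord0 i0) = t / 2 by rewrite /t exprS; field.
rewrite tt in a2.
rewrite -/Cf in a1 a2.
have half : 2 ^- k.+1 <= 2 ^- k :> R.
  by rewrite lef_pV2 ?posrE ?exp2_gt0// ler_eXn2l ?ltr1n// leqnSn.
have M0 := first_moment_ge0 Phi.
have {}a1 := le_trans a1 (ler_wpM2l (ler0n _ 2) (ler_wpM2r M0
  (ler_wpM2l Cf0 half))).
have {}b1 := le_trans b1 (ler_wpM2l (ler0n _ 2) (ler_wpM2r M0 (ler_wpM2l L0 half))).
set p1 := profile _ _ _ in a1 *; set p2 := profile _ _ _ in a2 *.
set A1 := average _ _ _ _ in a1 *; set A2 := average _ _ _ _ in a2 *.
set G1 := average _ _ _ _ in b1 *; set G2 := average _ _ _ _ in b2 *.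
rewrite (_ : _ - _ = ((A1 - v * p1) - (A2 - v * p2)) - ((G1 - g x) -
  (G2 - g x))); last by ring.
apply: le_trans (cabsB _ _) _.
have c1 := cabsB (A1 - v * p1) (A2 - v * p2).
have c2 := cabsB (G1 - g x) (G2 - g x).
rewrite (_ : 4 * _ * _ * _ = (2 * (Cf * 2 ^- k * M1) + 2 * (Cf * 2 ^- k * M1)) +
  (2 * (L * 2 ^- k * M1) + 2 * (L * 2 ^- k * M1))); last by ring.
apply: lerD; [apply: le_trans c1 _|apply: le_trans c2 _]; exact: lerD.
Qed.

(** The constant must be found before [g], since the closure provides [g] only after
a tolerance is given: here only the level at which the bound holds depends on [g]. *)
Lemma besov_face_lower (p : \bar R) : (0 < p)%E -> v != 0 ->
  exists2 c : R, 0 < c & forall g, schwartz g ->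
    (c%:E <= besov_norm Phi (inv_exponent p) p +oo
      (dist_sub (dist_of_fun f) (dist_of_fun g)))%E.
Proof.
move=> p0 v0; set s := inv_exponent p.
have [t0 [eta [dl [eta0 dl0 gap]]]] := profile_gap i0 sPhi Phi1.
have vp := cabs_gt0 v0.
pose del := cabs v * eta / 2.
have del0 : 0 < del by rewrite /del !mulr_gt0.
(* The slab A below has measure m0 2^-(k+1). *)
pose m0 := dl * r ^+ n.-1.
have m00 : 0 < m0 by rewrite mulr_gt0// exprn_gt0.
exists (del * m0 `^ s); first by rewrite mulr_gt0// powR_gt0.
move=> g sg; have [C HC] := block_approx sg.
have [K1 HK1] := @exp2_archimedean C del del0.
(* Beyond level K2 the heights 2^-(k+1) t with t in [t0, t0 + dl] stay within the
   range r / 2 of the face description. *)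
have [K2 HK2] := @exp2_archimedean (`|t0| + dl) (r / 2) (divr_gt0 r0 (ltr0n _ 2)).
pose k := maxn K1 K2.
have {}HK1 := HK1 k (leq_maxl _ _).
have {}HK2 := HK2 k.+1 (leq_trans (leq_maxr _ _) (leqnSn _)).
have k0 : 0 < 2 ^+ k.+1 :> R := exp2_gt0 k.+1.
set T := dist_sub _ _.
pose A := box (fun i => if i == i0 then
    `[z ord0 i0 + t0 / 2 ^+ k.+1, z ord0 i0 + (t0 + dl) / 2 ^+ k.+1]%classic
  else `[z ord0 i - r / 2, z ord0 i + r / 2]%classic : set (measurableTypeR R)).
have mA : measurable A by apply: measurable_box => i; case: ifP.
have muA : lebesgue_Rd n A = (m0 / 2 ^+ k.+1)%:E.
  rewrite lebesgue_Rd_box; last by move=> i; case: ifP.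
  rewrite (bigD1 i0)//= eqxx lebesgue_measure_itv/= lte_fin ltrD2l ltr_pM2r
    ?invr_gt0//.
  rewrite ltrDl dl0 -EFinB.
  rewrite (eq_bigr (fun=> r%:E)); last first.
    move=> i /negPf ->; rewrite lebesgue_measure_itv/= lte_fin ltrD2l ifT;
      last by have := r0; lra.
    by rewrite -EFinB; congr (_%:E); field.
  rewrite prodEFin prodr_const -EFinM; congr (_%:E).
  have -> : #|(fun i : 'I_n => i != i0)| = n.-1.
    by have := cardC1 i0; rewrite card_ord.
  by rewrite /m0; field; rewrite gt_eqF.
have LA x : A x -> del <= cabs (LP_block Phi k.+1 T x).
  move=> Ax.
  have := Ax i0; rewrite /= eqxx /= in_itv/= => /andP[x1 x2].
  have tx : t0 <= 2 ^+ k.+1 * (x ord0 i0 - z ord0 i0) <= t0 + dl.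
    rewrite mulrC -(ler_pdivrMr _ _ k0) -(ler_pdivlMr _ _ k0); apply/andP;
      split; lra.
  have xz : `|x - z| <= r / 2.
    apply: norm_le_coord; first by rewrite divr_ge0// ltW.
    move=> i; rewrite !mxE; have := Ax i; rewrite /=; case: eqVneq => [->|_].
      move=> _; apply: le_trans HK2.
      rewrite ler_pdivlMr// -[X in _ * X](gtr0_norm k0) -normrM mulrC.
      move: tx => /andP[h1 h2].
      have := ler_norm t0; have := ler_norm (- t0); rewrite normrN => h3 h4.
      rewrite ler_norml; apply/andP; split; lra.
    by rewrite /= in_itv/= => /andP[h1 h2]; rewrite ler_norml; apply/andP;
      split; lra.
  have := HC k x xz => /= H; have {}H := le_trans H HK1.
  have G := gap _ tx.
  set W := v * _ in H; set LL := LP_block _ _ _ _ in H *.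
  have W1 : cabs v * eta <= cabs W by rewrite /W cabsM ler_wpM2l ?cabs_ge0.
  have W2 : cabs W <= cabs LL + cabs (LL - W).
    by apply: le_trans (cabsB _ _); rewrite subKr.
  have : cabs v * eta = del + del by rewrite /del; field.
  lra.
apply: le_trans (Lnorm_counting_infty_ge _ k.+1).
apply: (@le_trans _ _ ((2 `^ (s * k.+1%:R))%:E * (del *
  (m0 / 2 ^+ k.+1) `^ s)%:E)%E); last first.
  apply: lee_pmul => //; rewrite ?lee_fin ?powR_ge0//.
    by rewrite mulr_ge0 ?powR_ge0// ltW.
  by apply: (Lp_norm_lower p0 mA muA) => //; rewrite divr_gt0.
rewrite -EFinM lee_fin le_eqVlt; apply/orP; left; apply/eqP.
(* With s = 1/p the weight 2^(s(k+1)) cancels the measure factor 2^-(k+1) exactly. *)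
have -> : 2 `^ (s * k.+1%:R) = (2 ^+ k.+1) `^ s.
  by rewrite mulrC powRrM powR_mulrn.
rewrite mulrCA -powRM ?divr_ge0 ?exprn_ge0//; last exact: ltW.
by rewrite [2 ^+ _ * _]mulrC mulfVK// gt_eqF.
Qed.

End face.
End lower_bound.

(** * The integral of the kernel, and the zero distribution *)

Section kernel.
Context {R : realType} {n : nat} (Phi : 'rV[R]_n -> R[i]).

(** This is the value of the Fourier transform of Phi at the origin. *)
Lemma LP_kernel_integral : LP_kernel Phi -> cintegral Phi = 1.
Proof.
move=> [_ /(_ 0) H _].
rewrite -[RHS]H; last by rewrite /dotr big1 ?ler01// => i _; rewrite mxE mul0r.
congr cintegral; apply/funext => x.
have -> : dotr x 0 = 0 by rewrite /dotr big1// => i _; rewrite mxE mulr0.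
by rewrite cos0 sin0 oppr0 mulr1.
Qed.

Lemma partial_zero (s : seq 'I_n) : partial s (fun=> 0 : R) = (fun=> 0).
Proof.
elim: s => //= i s ->; apply/funext => x.
exact: derive_cst.
Qed.

Lemma schwartz_zero : schwartz (fun _ : 'rV[R]_n => 0 : R[i]).
Proof.
split => [s x|s x|N]; try by rewrite /= partial_zero; exact: differentiable_cst.
apply: (@le_lt_trans _ _ 0%E); last exact: ltry.
apply: ub_ereal_sup => _ [[s x] _ <-] /=.
by rewrite /cpartial /= partial_zero cabs0 mulr0.
Qed.

Lemma dist_of_fun_zero : dist_of_fun (fun _ : 'rV[R]_n => 0 : R[i]) = (fun=> 0).
Proof.
apply/funext => phi; rewrite /dist_of_fun /cintegral.
under eq_Rintegral do rewrite mul0r/=.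
under [X in _ +i* X]eq_Rintegral do rewrite mul0r/=.
by rewrite Rintegral_cst// mul0r.
Qed.

Lemma besov_norm_zero (s : R) (p : \bar R) : (0 < p)%E ->
  besov_norm Phi s p +oo (fun=> 0) = 0%E.
Proof.
move=> p0; rewrite /besov_norm; set u := (fun k : nat => _).
rewrite (_ : u = cst 0%E) ?Lnorm0//; apply/funext => k.
rewrite /u /Lp_norm (_ : (fun _ => _) = cst 0%E).
  by rewrite Lnorm0 ?mule0// gt_eqF.
by apply/funext => x; rewrite /LP_block cabs0.
Qed.

Lemma zero_in_closure (s : R) (p : \bar R) : (0 < p)%E ->
  besov_schwartz_closure Phi s p +oo (dist_of_fun (fun=> 0)).
Proof.
move=> p0; split; [split|].
- split=> [a phi psi _ _|]; first by rewrite dist_of_fun_zero mulr0 addr0.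
  by exists 0%N, 0 => phi _; rewrite dist_of_fun_zero cabs0 mul0e.
- by rewrite dist_of_fun_zero besov_norm_zero.
- move=> e e0; exists (fun=> 0); split; first exact: schwartz_zero.
  rewrite (_ : dist_sub _ _ = (fun=> 0)); first by rewrite besov_norm_zero.
  by apply/funext => phi; rewrite /dist_sub dist_of_fun_zero subr0.
Qed.

End kernel.

Theorem proposition5p1 (R : realType) (d : nat) (p : \bar R)
    (Phi : 'rV[R]_d -> R[i]) :
  (1 <= d)%N -> (0 < p)%E -> LP_kernel Phi ->
  [set f : 'rV[R]_d -> R[i] |
    besov_schwartz_closure Phi (inv_exponent p) p +oo%E (dist_of_fun f)]
  `&` cspan haar_system = [set fun=> 0].
Proof.
move=> d1 p0 kPhi; have [sPhi _ _] := kPhi.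
apply/seteqP; split => [f [[_ cl] sp]|_ ->]; last first.
  split; first exact: zero_in_closure.
  by exists 0%N, (fun=> 0), (fun=> fun=> 0); split => [[]//|];
    apply/funext => x; rewrite big_ord0.
apply: contrapT => f0.
have [x fx] : exists x, f x != 0.
  by apply: contrapT => /forallNP H; apply: f0; apply/funext => x;
    apply/eqP/negPn/negP; exact: H.
pose i0 := Ordinal d1.
have [K fK] := cspan_haar_dyadic sp; have [B fB] := cspan_haar_bounded sp.
have [M fM] := cspan_haar_support i0 sp.
have [z [r [v [r0 v0 fz]]]] := jump_face fK fM fx.
have [c c0 Hc] := besov_face_lower sPhi (LP_kernel_integral kPhi)
  (cmeasurable_dyadic fK) fB r0 fz p0 v0.
have [g [sg gc]] := cl c c0.
by have := lt_le_trans gc (Hc g sg); rewrite ltxx.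
Qed.
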